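(* Let $F(z)=\sum_{k=0}^{n}A_kz^{n-k}\in\mathbb C[z]^{p\times p}$ be a monic matrix polynomial ($A_0=I_p$) of degree $n$, with even part $F_e$ and odd part $F_o$. Suppose that $\mathscr S=(\mathbf s_k)_{k=0}^{\infty}$ is the sequence of right (resp. left) Markov parameters of $F$ when $n=2m$, or the sequence of right (resp. left) Markov parameters of second type of $F$ when $n=2m+1$. Assume that every $\mathbf s_k$ is a Hermitian matrix. Let $\widehat F(z)$ be a greatest right common divisor (resp. greatest left common divisor) of $F_e(-z^2)$ and $zF_o(-z^2)$. Then: (i) if $n=2m$, $\gamma'_-(F)=\pi(H_{m-1}^{\langle\mathscr S\rangle})+\pi(H_{1,m-1}^{\langle\mathscr S\rangle})+\gamma_+(\widehat F)$, $\gamma'_+(F)=\nu(H_{m-1}^{\langle\mathscr S\rangle})+\nu(H_{1,m-1}^{\langle\mathscr S\rangle})+\gamma_-(\widehat F)$, $\gamma'_0(F)=\delta(H_{m-1}^{\langle\mathscr S\rangle})+\delta(H_{1,m-1}^{\langle\mathscr S\rangle})-\gamma_+(\widehat F)-\gamma_-(\widehat F)$; (ii) if $n=2m+1$, $\gamma'_-(F)=\pi(H_{m}^{\langle\mathscr S\rangle})+\pi(H_{1,m-1}^{\langle\mathscr S\rangle})+\gamma_+(\widehat F)$, $\gamma'_+(F)=\nu(H_{m}^{\langle\mathscr S\rangle})+\nu(H_{1,m-1}^{\langle\mathscr S\rangle})+\gamma_-(\widehat F)$, $\gamma'_0(F)=\delta(H_{m}^{\langle\mathscr S\rangle})+\delta(H_{1,m-1}^{\langle\mathscr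 S\rangle})-\gamma_+(\widehat F)-\gamma_-(\widehat F)$.
   Context: Even/odd parts: for $F(z)=\sum_{k=0}^nA_kz^{n-k}$, if $n=2m$ then $F_e(z)=\sum_{k=0}^mA_{2k}z^{m-k}$, $F_o(z)=\sum_{k=1}^mA_{2k-1}z^{m-k}$; if $n=2m+1$ then $F_e(z)=\sum_{k=0}^mA_{2k+1}z^{m-k}$, $F_o(z)=\sum_{k=0}^mA_{2k}z^{m-k}$; thus $F(z)=F_e(z^2)+zF_o(z^2)$. Markov parameters: for $n=2m$, the right (resp. left) Markov parameters $(\mathbf s_k)_{k\ge0}$ are defined by the Laurent expansion, valid for large $|z|$, $F_o(z)F_e(z)^{-1}=\sum_{k\ge0}(-1)^kz^{-(k+1)}\mathbf s_k$ (resp. $F_e(z)^{-1}F_o(z)=\sum_{k\ge0}(-1)^kz^{-(k+1)}\mathbf s_k$). For $n=2m+1$, the right (resp. left) Markov parameters of second type are defined by $F_e(z)F_o(z)^{-1}=\sum_{k\ge0}(-1)^kz^{-k}\mathbf s_k$ (resp. $F_o(z)^{-1}F_e(z)=\sum_{k\ge0}(-1)^kz^{-k}\mathbf s_k$) for large $|z|$. Block Hankel matrices: $H_{j,k}^{\langle\mathscr S\rangle}=[\mathbf s_{j+a+b}]_{a,b=0}^{k}$ (a $(k+1)p\times(k+1)p$ matrix) and $H_k^{\langle\mathscr S\rangle}=H_{0,k}^{\langle\mathscr S\rangle}$. For a square matrix $A$, $\pi(A),\nu(A),\delta(A)$ are the numbers of eigenvalues (with algebraic multiplicity) with positive, negative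 and zero real part. For a regular matrix polynomial $L$ (i.e. $\det L\not\equiv0$), a zero is a root of $\det L$, counted with its multiplicity as a root of $\det L$; $\gamma_+(L),\gamma_-(L),\gamma_0(L)$ are the numbers of zeros in the open upper half-plane, open lower half-plane and on the real axis; $\gamma'_+(L),\gamma'_-(L),\gamma'_0(L)$ are the numbers of zeros in the open right half-plane, open left half-plane and on the imaginary axis. $L$ is a right (resp. left) divisor of $F$ if $F=ML$ (resp. $F=LM$) for some matrix polynomial $M$; a greatest right (resp. left) common divisor of $F,\widetilde F$ is a right (resp. left) common divisor of both such that every right (resp. left) common divisor of $F,\widetilde F$ is a right (resp. left) divisor of it. *)

(* Defs.v *)
From HB Require Import structures.
From mathcomp Require Import all_boot all_order all_algebra.
From mathcomp Require Import complex.
From mathcomp Require Import Rstruct.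
From Stdlib Require Reals.

Set Implicit Arguments.
Unset Strict Implicit.
Unset Printing Implicit Defensive.
Import Order.TTheory GRing.Theory Num.Theory.
Local Open Scope ring_scope.

Notation C := (complex Rdefinitions.R).

Notation matpoly p := 'M[{poly C}]_p.

(* The multiset of roots of q (for q <> 0): q = lead_coef q * prod (X - z). *)
Definition poly_zeros (q : {poly C}) : seq C :=
  sval (closed_field_poly_normal q).

Definition nzeros (P : pred C) (q : {poly C}) : nat := count P (poly_zeros q).

Definition gamma_up   p (L : matpoly p) := nzeros (fun z => 0 < 'Im z) (\det L).
Definition gamma_down p (L : matpoly p) := nzeros (fun z => 'Im z < 0) (\det L).
Definition gamma_real p (L : matpoly p) := nzeros (fun z => 'Im z == 0) (\det L).
Definition gamma_right p (L : matpoly p) := nzeros (fun z => 0 < 'Re z) (\det L).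
Definition gamma_left  p (L : matpoly p) := nzeros (fun z => 'Re z < 0) (\det L).
Definition gamma_imag  p (L : matpoly p) := nzeros (fun z => 'Re z == 0) (\det L).

Definition inertia_pos n (A : 'M[C]_n) := nzeros (fun z => 0 < 'Re z) (char_poly A).
Definition inertia_neg n (A : 'M[C]_n) := nzeros (fun z => 'Re z < 0) (char_poly A).
Definition inertia_zero n (A : 'M[C]_n) := nzeros (fun z => 'Re z == 0) (char_poly A).

Definition hermitian_mx n (A : 'M[C]_n) : Prop := map_mx Num.conj A^T = A.

Definition mpoly_of p (c : nat -> 'M[C]_p) (d : nat) : matpoly p :=
  \matrix_(i, j) \sum_(k < d.+1) (c k i j)%:P * 'X^(d - k)%N.

Definition coefA p (F : matpoly p) (n k : nat) : 'M[C]_p :=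
  if (k <= n)%N then \matrix_(i, j) (F i j)`_(n - k)%N else 0.

Definition monic_mpoly_deg p (F : matpoly p) (n : nat) : Prop :=
  (forall i j, size (F i j) <= n.+1)%N /\ coefA F n 0 = 1%:M.

(* Even and odd parts, so that F(z) = F_e(z^2) + z F_o(z^2).
   m = n./2.  Coefficient sequences (coefficient of z^(m-k)): *)
Definition even_coef p (F : matpoly p) (n k : nat) : 'M[C]_p :=
  if ~~ odd n then coefA F n (2 * k)%N else coefA F n (2 * k + 1)%N.
Definition odd_coef p (F : matpoly p) (n k : nat) : 'M[C]_p :=
  if ~~ odd n then (if k == 0%N then 0 else coefA F n (2 * k - 1)%N)
  else coefA F n (2 * k)%N.

Definition even_part p (F : matpoly p) (n : nat) : matpoly p :=
  mpoly_of (even_coef F n) n./2.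
Definition odd_part p (F : matpoly p) (n : nat) : matpoly p :=
  mpoly_of (odd_coef F n) n./2.

Definition mcoef p (P : matpoly p) (d k : nat) : 'M[C]_p :=
  if (k <= d)%N then \matrix_(i, j) (P i j)`_(d - k)%N else 0.

(* ---------- Markov parameters (Laurent expansions at infinity) ----------
   Let Q have degree d with invertible leading coefficient.  The identity
     P(z) Q(z)^{-1} = sum_{k>=0} (-1)^k z^{-(k+1)} s_k        (large |z|)
   is equivalent to the identity of formal Laurent series in 1/z
     P(z) = (sum_k (-1)^k z^{-(k+1)} s_k) Q(z),
   i.e. deg P < d and the coefficient of z^(d-1-t) of P equals
   sum_{k<=t} (-1)^k s_k Q_{t-k}  (Q_j := coefficient of z^(d-j)). *)
Definition laurent1_right p (P Q : matpoly p) (d : nat) (s : nat -> 'M[C]_p) :=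
  (forall i j, size (P i j) <= d)%N /\
  forall t : nat, mcoef P d t.+1 =
    \sum_(k < t.+1) (((-1) ^+ k) *: s k) *m mcoef Q d (t - k)%N.
(* Q(z)^{-1} P(z) = sum_k (-1)^k z^{-(k+1)} s_k *)
Definition laurent1_left p (P Q : matpoly p) (d : nat) (s : nat -> 'M[C]_p) :=
  (forall i j, size (P i j) <= d)%N /\
  forall t : nat, mcoef P d t.+1 =
    \sum_(k < t.+1) mcoef Q d (t - k)%N *m (((-1) ^+ k) *: s k).
(* P(z) Q(z)^{-1} = sum_{k>=0} (-1)^k z^{-k} s_k *)
Definition laurent2_right p (P Q : matpoly p) (d : nat) (s : nat -> 'M[C]_p) :=
  (forall i j, size (P i j) <= d.+1)%N /\
  forall t : nat, mcoef P d t =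
    \sum_(k < t.+1) (((-1) ^+ k) *: s k) *m mcoef Q d (t - k)%N.
(* Q(z)^{-1} P(z) = sum_{k>=0} (-1)^k z^{-k} s_k *)
Definition laurent2_left p (P Q : matpoly p) (d : nat) (s : nat -> 'M[C]_p) :=
  (forall i j, size (P i j) <= d.+1)%N /\
  forall t : nat, mcoef P d t =
    \sum_(k < t.+1) mcoef Q d (t - k)%N *m (((-1) ^+ k) *: s k).

Definition markov_params (right : bool) p (F : matpoly p) (n : nat)
    (s : nat -> 'M[C]_p) : Prop :=
  let Fe := even_part F n in
  let Fo := odd_part F n in
  let m := n./2 in
  if ~~ odd n then
    (if right then laurent1_right Fo Fe m s else laurent1_left Fo Fe m s)
  else
    (if right then laurent2_right Fe Fo m s else laurent2_left Fe Fo m s).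

(* ---------- block Hankel matrices ----------
   hankel s j k = [s_(j+a+b)]_{a,b=0}^{k-1}, a k p x k p matrix.
   In the paper's notation H_{j,k} = hankel s j (k+1) and H_k = hankel s 0 (k+1). *)
Definition hankel p (s : nat -> 'M[C]_p) (j k : nat) :=
  \mxblock_(a < k, b < k) s (j + a + b)%N.

Definition rdivides p (L F : matpoly p) : Prop := exists M : matpoly p, F = M *m L.
Definition ldivides p (L F : matpoly p) : Prop := exists M : matpoly p, F = L *m M.

Definition is_gcrd p (D F G : matpoly p) : Prop :=
  [/\ rdivides D F, rdivides D G &
      forall L, rdivides L F -> rdivides L G -> rdivides L D].
Definition is_gcld p (D F G : matpoly p) : Prop :=
  [/\ ldivides D F, ldivides D G &
      forall L, ldivides L F -> ldivides L G -> ldivides L D].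

Definition subst_negsq p (P : matpoly p) : matpoly p :=
  map_mx (fun q : {poly C} => q \Po (- 'X ^+ 2)) P.

(* Main.v *)
(* Put D - iN for F(ix) up to a unit, D and N collecting the coefficients of even
   and odd index, so that D^-1 N = sum_j sig_j x^-(j+1) with sig Hermitian and
   sig_(2k) = s_k, sig_odd = 0.  Let A be the block companion matrix of D,
   E = [1, 0, ..., 0], Gam = [sig_(a+b)] and ^H the adjoint.  Then A Gam = Gam A^H, and
   K = A + i Gam E^H E satisfies K Gam - Gam K^H = 2i (Gam E^H)(Gam E^H)^H, so
   modulo ker Gam the signs of Im on the spectrum of K give the inertia of Gam.
   That quotient is a minimal realization, whence
   det (D - iN) = c det Fh * char_poly K1 for the induced matrix K1; and Gam is
   congruent to the direct sum of the two Hankel matrices of s.  The statement for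
   right Markov parameters follows by transposition. *)

Require Import Defs.
From HB Require Import structures.
From mathcomp Require Import all_boot all_order all_algebra.
From mathcomp Require Import complex.
From mathcomp Require Import Rstruct.
From mathcomp Require Import zify ring.

Set Implicit Arguments.
Unset Strict Implicit.
Unset Printing Implicit Defensive.
Import Order.TTheory GRing.Theory Num.Theory.
Local Open Scope ring_scope.

(** A zero [w] of F is a zero [w / i] of [F(ix)], and [Im (w / i) = - Re w]: left zeros go to the
    upper half-plane. The powers of i also absorb the signs [(-1)^k] of the Laurent expansions, so
    both parities of n obey one recurrence. The obstacle is that [Gam] is singular as soon as D and
    N have a common left divisor that is not unimodular; an eigenvector v of K with [v Gam E^H = 0]
    then gets no sign. The kernel of [Gam] accounts for exactly the zeros of [Fh], whose position is
    unrestricted, so they are counted apart. Only the open half-planes are compared. The count on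
    the axis follows from totals: [\det F] has degree [n p], which is also the sum of the sizes of
    the two Hankel matrices. *)

Local Notation "A ^H" := (map_mx Num.conj A^T)
  (at level 8, format "A ^H").

(** * Adjoint matrices and Sylvester's law of inertia *)

Lemma adjmxK (K : numClosedFieldType) m n (A : 'M[K]_(m, n)) : (A^H)^H = A.
Proof. by apply/matrixP => i j; rewrite !mxE conjCK. Qed.

Lemma adjmxM (K : numClosedFieldType) m n r (A : 'M[K]_(m, n))
    (B : 'M[K]_(n, r)) : (A *m B)^H = B^H *m A^H.
Proof. by rewrite trmx_mul map_mxM. Qed.

Lemma adjmx1 (K : numClosedFieldType) n : (1%:M : 'M[K]_n)^H = 1%:M.
Proof. by rewrite trmx1 map_mx1. Qed.

Lemma adjmxD (K : numClosedFieldType) m n (A B : 'M[K]_(m, n)) :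
  (A + B)^H = A^H + B^H.
Proof. by rewrite linearD map_mxD. Qed.

Lemma adjmxZ (K : numClosedFieldType) m n a (A : 'M[K]_(m, n)) :
  (a *: A)^H = Num.conj a *: A^H.
Proof. by rewrite linearZ map_mxZ. Qed.

Lemma adjmx_row (K : numClosedFieldType) m n1 n2 (A : 'M[K]_(m, n1))
    (B : 'M[K]_(m, n2)) : (row_mx A B)^H = col_mx A^H B^H.
Proof. by rewrite tr_row_mx map_col_mx. Qed.

Lemma adjmx_col (K : numClosedFieldType) m1 m2 n (A : 'M[K]_(m1, n))
    (B : 'M[K]_(m2, n)) : (col_mx A B)^H = row_mx A^H B^H.
Proof. by rewrite tr_col_mx map_row_mx. Qed.

Lemma hermitian_diag (K : numClosedFieldType) n (A : 'M[K]_n) : A^H = A ->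
  exists (U : 'M[K]_n) (d : 'rV[K]_n),
    [/\ U *m U^H = 1%:M, U^H *m U = 1%:M, forall i, d 0 i \is Num.real
      & A = U^H *m diag_mx d *m U].
Proof.
move=> AH; have hA : A \is hermsymmx.
  by apply/is_hermitianmxP; rewrite expr0 scale1r.
have UU := spectral_unitarymx A.
exists (spectralmx A), (spectral_diag A); split.
- exact/unitarymxP.
- by rewrite -invmx_unitary // mulVmx // unitarymx_unit.
- move=> i; have /mxOverP := hermitian_spectral_diag_real hA; exact.
- by rewrite -invmx_unitary //; apply/orthomx_spectralP/hermitian_normalmx.
Qed.

Lemma row_mul_diag_adj (K : numClosedFieldType) n (x d : 'rV[K]_n) :
  (x *m diag_mx d *m x^H) 0 0 = \sum_i d 0 i * `|x 0 i| ^+ 2.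
Proof.
rewrite mxE; apply: eq_bigr => i _.
by rewrite mul_mx_diag !mxE mulrAC normCK mulrC.
Qed.

(* If d had more positive entries than e, then some x supported on the positive
   entries of d would have x S vanishing on those of e, and x d x^H would be both
   positive and nonpositive. *)
Lemma sylvester_pos_le (K : numClosedFieldType) n m (d : 'rV[K]_n)
    (e : 'rV[K]_m) (S : 'M[K]_(n, m)) :
  (forall j, e 0 j \is Num.real) ->
  diag_mx d = S *m diag_mx e *m S^H ->
  (#|[set i | (0 < d 0 i)%R]| <= #|[set j | (0 < e 0 j)%R]|)%N.
Proof.
set I := [set i | _]; set J := [set j | _] => er dE; rewrite leqNgt.
apply/negP => ltJI.
pose PI : 'M[K]_(#|I|, n) := rowsub enum_val 1%:M.
pose M : 'M[K]_(#|I|, #|J|) := colsub enum_val (PI *m S).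
have: kermx M != 0.
  rewrite kermx_eq0 /row_free neq_ltn.
  by rewrite (leq_ltn_trans (rank_leq_col _) ltJI).
case/rowV0Pn => y /sub_kermxP yM y0.
pose x := y *m PI.
have xE i : x 0 (enum_val i) = y 0 i.
  rewrite mxE (bigD1 i) //= big1 ?addr0 => [|k ki]; rewrite !mxE ?eqxx ?mulr1 //.
  by rewrite (inj_eq enum_val_inj) (negPf ki) mulr0.
have xn i : i \notin I -> x 0 i = 0.
  move=> iI; rewrite mxE big1 // => k _; rewrite !mxE.
  case: eqP => [ki|]; rewrite ?mulr0 //.
  by rewrite -ki enum_valP in iI.
have : 0 < (x *m diag_mx d *m x^H) 0 0.
  have /rV0Pn[k yk] := y0.
  have Ik : enum_val k \in I by apply: enum_valP.
  rewrite row_mul_diag_adj (bigD1 (enum_val k)) //=; apply: ltr_pwDl.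
    by rewrite mulr_gt0 ?exprn_gt0 ?normr_gt0 ?xE //; rewrite inE in Ik.
  apply: sumr_ge0 => i _; case: (boolP (i \in I)) => [|/xn->].
    by rewrite inE => di; rewrite mulr_ge0 ?exprn_ge0 ?(ltW di).
  by rewrite normr0 expr0n mulr0.
suff: (x *m diag_mx d *m x^H) 0 0 <= 0.
  by move=> h1 h2; have := lt_le_trans h2 h1; rewrite ltxx.
have -> : x *m diag_mx d *m x^H = (x *m S) *m diag_mx e *m (x *m S)^H.
  by rewrite dE (adjmxM x S) !mulmxA.
rewrite row_mul_diag_adj; apply: sumr_le0 => j _.
case: (boolP (j \in J)) => jJ; last first.
  rewrite inE -real_leNgt ?real0 // in jJ.
  by rewrite mulr_le0_ge0 ?exprn_ge0.
suff -> : (x *m S) 0 j = 0 by rewrite normr0 expr0n mulr0.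
have /rowP/(_ (enum_rank_in jJ j)) := yM.
rewrite [in RHS]mxE => <-; rewrite -mulmxA mxE [RHS]mxE.
by apply: eq_bigr => k _; rewrite /M !mxE enum_rankK_in.
Qed.

Lemma sylvester_neg_le (K : numClosedFieldType) n m (d : 'rV[K]_n)
    (e : 'rV[K]_m) (S : 'M[K]_(n, m)) :
  (forall j, e 0 j \is Num.real) ->
  diag_mx d = S *m diag_mx e *m S^H ->
  (#|[set i | (d 0 i < 0)%R]| <= #|[set j | (e 0 j < 0)%R]|)%N.
Proof.
move=> er dE; have /sylvester_pos_le : diag_mx (- d) = S *m diag_mx (- e) *m S^H.
  by rewrite !linearN /= dE mulNmx.
have -> : [set j | 0 < (- e) 0 j] = [set j | e 0 j < 0].
  by apply/setP => j; rewrite !inE mxE oppr_gt0.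
have -> : [set j | 0 < (- d) 0 j] = [set j | d 0 j < 0].
  by apply/setP => j; rewrite !inE mxE oppr_gt0.
by apply => j; rewrite mxE realN.
Qed.

(** Rectangular [S] and [T] replace an invertible matrix: the forms may differ in size by a zero
    part, as [Gam] and its nondegenerate quotient do. Hence only the signed counts agree. *)
Lemma diag_congr_card (K : numClosedFieldType) n m (d : 'rV[K]_n)
    (e : 'rV[K]_m) (S : 'M[K]_(n, m)) (T : 'M[K]_(m, n)) :
  (forall j, d 0 j \is Num.real) -> (forall j, e 0 j \is Num.real) ->
  diag_mx d = S *m diag_mx e *m S^H -> diag_mx e = T *m diag_mx d *m T^H ->
  #|[set i | (0 < d 0 i)%R]| = #|[set j | (0 < e 0 j)%R]| /\
  #|[set i | (d 0 i < 0)%R]| = #|[set j | (e 0 j < 0)%R]|.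
Proof.
move=> dr er dE eE; split; apply/eqP; rewrite eqn_leq.
  by rewrite (sylvester_pos_le er dE) (sylvester_pos_le dr eE).
by rewrite (sylvester_neg_le er dE) (sylvester_neg_le dr eE).
Qed.

(** * Counting zeros of polynomials *)

Lemma poly_zerosE (q : {poly C}) :
  q = lead_coef q *: \prod_(z <- poly_zeros q) ('X - z%:P).
Proof. by rewrite /poly_zeros; case: closed_field_poly_normal. Qed.

(** [poly_zeros] is some enumeration of the roots; unique factorization makes it a permutation of
    [rs]. *)
Lemma nzeros_prod (P : pred C) a (rs : seq C) : a != 0 ->
  nzeros P (a *: \prod_(z <- rs) ('X - z%:P)) = count P rs.
Proof.
move=> a0; set q := a *: _; have := poly_zerosE q.
have -> : lead_coef q = a by rewrite lead_coefZ lead_coef_prod_XsubC mulr1.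
rewrite {1}/q => /(scalerI a0)/prod_XsubC_eq/permP/(_ P) e.
by rewrite e.
Qed.

Lemma nzerosM (P : pred C) (q r : {poly C}) : q != 0 -> r != 0 ->
  nzeros P (q * r) = (nzeros P q + nzeros P r)%N.
Proof.
move=> q0 r0; rewrite {1}(poly_zerosE q) {1}(poly_zerosE r).
rewrite -scalerAl -scalerAr scalerA -big_cat nzeros_prod.
  by rewrite count_cat.
by rewrite mulf_neq0 ?lead_coef_eq0.
Qed.

Lemma nzerosZ (P : pred C) a (q : {poly C}) : a != 0 -> q != 0 ->
  nzeros P (a *: q) = nzeros P q.
Proof.
move=> a0 q0; rewrite {1}(poly_zerosE q) scalerA nzeros_prod //.
by rewrite mulf_neq0 ?lead_coef_eq0.
Qed.

Lemma size_poly_zeros (q : {poly C}) : q != 0 ->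
  (size (poly_zeros q)).+1 = size q.
Proof.
move=> q0; rewrite {2}(poly_zerosE q) size_scale ?lead_coef_eq0 //.
by rewrite size_prod_XsubC.
Qed.

Lemma nzeros_comp_linear (P : pred C) a (q : {poly C}) : a != 0 -> q != 0 ->
  nzeros P (q \Po (a *: 'X)) = nzeros (fun z => P (z / a)) q.
Proof.
move=> a0 q0; rewrite {1}(poly_zerosE q) linearZ /= rmorph_prod /=.
have -> : \prod_(z <- poly_zeros q) (('X - z%:P) \Po (a *: 'X)) =
    a ^+ size (poly_zeros q) *: \prod_(z <- map (fun z => z / a) (poly_zeros q)) ('X - z%:P).
  elim: (poly_zeros q) => [|z s IH]; first by rewrite !big_nil expr0 scale1r.
  have lin : ('X - z%:P) \Po (a *: 'X) = a *: ('X - (z / a)%:P).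
    rewrite comp_polyB comp_polyX comp_polyC scalerBr; congr (_ - _).
    by rewrite -mul_polyC -polyCM mulrC divfK.
  by rewrite /= !big_cons IH lin -scalerAl -scalerAr scalerA -exprS.
rewrite scalerA nzeros_prod ?count_map //.
by rewrite mulf_neq0 ?expf_neq0 ?lead_coef_eq0.
Qed.

(** * Inertia of Hermitian matrices and the Lyapunov equation *)

Lemma char_poly_conj (K : fieldType) n (U V D : 'M[K]_n) : V *m U = 1%:M ->
  char_poly (U *m D *m V) = char_poly D.
Proof.
move=> VU; have UV := mulmx1C VU; rewrite /char_poly /char_poly_mx.
have -> : 'X%:M - map_mx polyC (U *m D *m V) =
    map_mx polyC U *m ('X%:M - map_mx polyC D) *m map_mx polyC V.
  rewrite mulmxBr mulmxBl -!map_mxM; congr (_ - _).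
  by rewrite scalar_mxC -mulmxA -map_mxM UV map_mx1 mulmx1.
by rewrite !det_mulmx mulrAC -det_mulmx -map_mxM UV map_mx1 det1 mul1r.
Qed.

Lemma char_poly_diag (K : fieldType) n (d : 'rV[K]_n) :
  char_poly (diag_mx d) = \prod_(z <- [seq d 0 i | i <- enum 'I_n]) ('X - z%:P).
Proof.
rewrite char_poly_trig ?diag_mx_is_trig // big_map big_enum /=.
by apply: eq_bigr => i _; rewrite mxE eqxx mulr1n.
Qed.

Lemma count_map_enum n (P : pred C) (f : 'I_n -> C) :
  count P [seq f i | i <- enum 'I_n] = #|[set i | P (f i)]|.
Proof.
rewrite count_map -sum1_count -sum1_card big_enum_cond.
by apply: eq_bigl => i; rewrite !inE.
Qed.

Lemma inertia_diag n (A : 'M[C]_n) : hermitian_mx A ->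
  exists (U V : 'M[C]_n) (d : 'rV[C]_n),
    [/\ forall i, d 0 i \is Num.real,
        A = U *m diag_mx d *m U^H /\ diag_mx d = V *m A *m V^H,
        inertia_pos A = #|[set i | (0 < d 0 i)%R]|,
        inertia_neg A = #|[set i | (d 0 i < 0)%R]|
      & inertia_zero A = #|[set i | d 0 i == 0]|].
Proof.
move=> /hermitian_diag[U [d [UU UU' dr AE]]]; exists U^H, U, d.
have cE : char_poly A = 1 *: \prod_(z <- [seq d 0 i | i <- enum 'I_n]) ('X - z%:P).
  by rewrite AE (char_poly_conj _ UU) char_poly_diag scale1r.
have dRe i : 'Re (d 0 i) = d 0 i by apply/Creal_ReP.
rewrite adjmxK; split=> //.
- by split=> //; rewrite AE !mulmxA UU mul1mx -mulmxA UU mulmx1.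
- rewrite /inertia_pos cE nzeros_prod ?oner_neq0 // count_map_enum.
  by apply: eq_card => i; rewrite !inE dRe.
- rewrite /inertia_neg cE nzeros_prod ?oner_neq0 // count_map_enum.
  by apply: eq_card => i; rewrite !inE dRe.
- rewrite /inertia_zero cE nzeros_prod ?oner_neq0 // count_map_enum.
  by apply: eq_card => i; rewrite !inE dRe.
Qed.

Lemma inertia_congr n m (A : 'M[C]_n) (B : 'M[C]_m) (S : 'M[C]_(n, m))
    (T : 'M[C]_(m, n)) : hermitian_mx A -> hermitian_mx B ->
  A = S *m B *m S^H -> B = T *m A *m T^H ->
  inertia_pos A = inertia_pos B /\ inertia_neg A = inertia_neg B.
Proof.
move=> /inertia_diag[U [V [d [dr [AU dV] -> -> _]]]].
move=> /inertia_diag[U' [V' [e [er [BU eV] -> -> _]]]] AE BE.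
apply: (@diag_congr_card _ _ _ d e (V *m S *m U') (V' *m T *m U)) => //.
  by rewrite dV AE BU !adjmxM !mulmxA.
by rewrite eV BE AU !adjmxM !mulmxA.
Qed.

Lemma count_sign_partition (f : C -> C) (rs : seq C) :
  (forall z, f z \is Num.real) ->
  (count (fun z => 0 < f z)%R rs + count (fun z => f z < 0)%R rs
   + count (fun z => f z == 0)%R rs)%N = size rs.
Proof.
move=> fr; elim: rs => //= z s <-.
by case: (real_ltgtP (fr z) (real0 _)) => _ /=; lia.
Qed.

Lemma inertia_total n (A : 'M[C]_n) :
  (inertia_pos A + inertia_neg A + inertia_zero A)%N = n.
Proof.
rewrite /inertia_pos /inertia_neg /inertia_zero /nzeros.
rewrite (count_sign_partition _ (fun z => Creal_Re z)); apply: succn_inj.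
by rewrite size_poly_zeros ?size_char_poly // monic_neq0 ?char_poly_monic.
Qed.

(* Each eigenvector v of A satisfies (Im l) v Gam v^H = |v B|^2 > 0; the induction
   passes to the Gam-orthogonal complement of v, on which A acts modulo v. *)
Lemma lyapunov_inertia (K : numClosedFieldType) n r (A Gam : 'M[K]_n)
    (B : 'M[K]_(n, r)) :
  Gam^H = Gam -> A *m Gam - Gam *m A^H = (2 * 'i) *: (B *m B^H) ->
  (forall l (v : 'rV_n), v *m A = l *: v -> v *m B = 0 -> v = 0) ->
  exists (T : 'M[K]_n) (d z : 'rV[K]_n),
    [/\ T \in unitmx, T *m Gam *m T^H = diag_mx d,
        forall i, d 0 i \is Num.real, forall i, 0 < d 0 i * 'Im (z 0 i)
      & char_poly A = \prod_i ('X - (z 0 i)%:P)].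
Proof.
elim: n => [|n IH] in A Gam B *.
  move=> _ _ _; exists 1%:M, 0, 0; split; try by case.
  - exact: unitmx1.
  - by apply/matrixP => -[].
  - by rewrite /char_poly det_mx00 big_ord0.
move=> GamH AGam obs.
have [l /eigenvalueP[v vA v0]] := eigenvalue_closed A (ltn0Sn n).
pose c := Gam *m v^H; pose q := (v *m c) 0 0.
(* The Lyapunov equation tested with [w] on the left and [v^H] on the right. Taking [w = v] yields
   the sign of [Im l]; taking [w] orthogonal to [v] controls the coupling with the complement. *)
have cA (w : 'rV[K]_n.+1) :
    w *m A *m c - Num.conj l *: (w *m c) = (2 * 'i) *: (w *m B *m (v *m B)^H).
  have -> : w *m B *m (v *m B)^H = w *m (B *m B^H) *m v^H.
    by rewrite adjmxM !mulmxA.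
  rewrite [RHS]scalemxAl [in RHS]scalemxAr -AGam mulmxBr mulmxBl /c -!mulmxA; congr (_ - _).
  by rewrite -adjmxM vA adjmxZ -!scalemxAr.
have vB0 : v *m B != 0 by apply: contra_neq v0; apply: obs vA.
have ImlE : 'Im l * q = \sum_i `|(v *m B) 0 i| ^+ 2.
  have := congr1 (fun M : 'M_1 => M 0 0) (cA v).
  rewrite vA -scalemxAl -scalerBl mxE -/q [RHS]mxE.
  have -> : l - Num.conj l = 2 * 'i * 'Im l.
    rewrite {1 2}(Crect l) conjC_rect ?Creal_Re ?Creal_Im //; ring.
  have i0 : (2 * 'i : K) != 0 by rewrite mulf_neq0 ?neq0Ci // pnatr_eq0.
  rewrite -[2 * 'i * 'Im l * q]mulrA => /(mulfI i0) ->; rewrite mxE.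
  by apply: eq_bigr => i _; rewrite !mxE normCK.
have ImlQ : 0 < q * 'Im l.
  rewrite mulrC ImlE; have /rV0Pn[k vk] := vB0.
  rewrite (bigD1 k) //= ltr_pwDl ?exprn_gt0 ?normr_gt0 //.
  by apply: sumr_ge0 => i _; rewrite exprn_ge0.
have q0 : q != 0 by apply: contraTneq ImlQ => ->; rewrite mul0r ltxx.
have qE : v *m c = q%:M by apply/matrixP => i j; rewrite !ord1 [RHS]mxE eqxx mulr1n.
have qr : q \is Num.real.
  apply/CrealP; have := congr1 (fun M : 'M_1 => M 0 0) (adjmxM v c).
  by rewrite mxE mxE -/q => ->; rewrite /c adjmxM adjmxK GamH -mulmxA.
have rc : \rank (kermx c) = n.
  rewrite mxrank_ker; suff -> : \rank c = 1%N by rewrite subn1.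
  apply/eqP; rewrite eqn_leq rank_leq_col lt0n mxrank_eq0.
  by apply: contra_neq q0 => c0; rewrite /q c0 mulmx0 mxE.
have [W [Wf Wc]] : exists W : 'M[K]_(n, n.+1), row_free W /\ W *m c = 0.
  have : row_free (row_base (kermx c)) /\ row_base (kermx c) *m c = 0.
    by rewrite row_base_free; split=> //; apply/sub_kermxP; rewrite eq_row_base.
  by move: (row_base _); rewrite rc => W WP; exists W.
have Wv : W *m Gam *m v^H = 0 by rewrite -mulmxA.
have vW : v *m Gam *m W^H = 0.
  have := congr1 (fun X => X^H) Wv.
  by rewrite !adjmxM adjmxK GamH mulmxA trmx0 map_mx0.
pose T0 : 'M[K]_(1 + n) := col_mx v W.
have T0u : T0 \in unitmx.
  rewrite -row_free_unit; apply: inj_row_free => x.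
  rewrite -[x]hsubmxK mul_row_col => xE.
  have x1 : lsubmx x = 0.
    have := congr1 (mulmx^~ c) xE; rewrite mulmxDl -!mulmxA Wc mulmx0 addr0 mul0mx.
    by rewrite qE mul_mx_scalar => /eqP; rewrite scaler_eq0 (negPf q0) => /eqP.
  move: xE; rewrite x1 mul0mx add0r => xE.
  by rewrite (row_free_inj Wf (etrans xE (esym (mul0mx _ W)))) row_mx0.
pose M := T0 *m A *m invmx T0.
have T0A : T0 *m A = M *m T0 by rewrite mulmxKV.
have ME : M = block_mx l%:M 0 (dlsubmx M) (drsubmx M).
  rewrite -{1}[M]submxK.
  suff: usubmx M = row_mx l%:M 0.
    by move=> /[dup] /(congr1 lsubmx) + /(congr1 rsubmx); rewrite row_mxKl row_mxKr => <- <-.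
  have -> : usubmx M = v *m A *m invmx T0.
    by rewrite /M -mulmxA -mul_usub_mx col_mxKu mulmxA.
  have -> : v *m A = row_mx l%:M 0 *m T0.
    by rewrite mul_row_col mul0mx addr0 mul_scalar_mx.
  by rewrite mulmxK.
set a' := dlsubmx M in ME; set A' := drsubmx M in ME.
have WA : W *m A = a' *m v + A' *m W.
  have := congr1 (@dsubmx _ 1 n _) T0A.
  by rewrite ME mul_block_col mul_col_mx !col_mxKd.
have [||mu w wA' wB|T [d [z [Tu Td dr dz cz]]]] := IH A' (W *m Gam *m W^H) (W *m B).
- by rewrite !adjmxM adjmxK GamH mulmxA.
(* The part of [W A] along [v] disappears after multiplication by [Gam W^H], so [A'] inherits the
   Lyapunov equation. *)
- have E : A' *m W = W *m A - a' *m v by rewrite WA addrC addKr.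
  have -> : A' *m (W *m Gam *m W^H) = W *m (A *m Gam) *m W^H.
    rewrite !mulmxA E !mulmxBl -[a' *m v *m Gam]mulmxA -[X in _ - X]mulmxA vW.
    by rewrite mulmx0 subr0.
  have -> : W *m Gam *m W^H *m A'^H = W *m (Gam *m A^H) *m W^H.
    have EH : W^H *m A'^H = A^H *m W^H - v^H *m a'^H.
      by rewrite -!adjmxM E linearB map_mxB.
    rewrite -[LHS]mulmxA EH mulmxBr !mulmxA Wv.
    by rewrite mul0mx subr0.
  by rewrite -mulmxBl -mulmxBr AGam -scalemxAr -scalemxAl adjmxM !mulmxA.
- have wWA : w *m W *m A = (w *m a') *m v + mu *: (w *m W).
    by rewrite -mulmxA WA mulmxDr !mulmxA wA' scalemxAl.
  have wWc : w *m W *m c = 0 by rewrite -mulmxA Wc mulmx0.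
  have wWB : w *m W *m B = 0 by rewrite -mulmxA.
  (* [w W] is an eigenvector of [A] modulo [v]. As [w W B = 0], the tested equation leaves
     [(w a') q = 0]: it is a genuine eigenvector and [obs] applies. *)
  have wa : w *m a' = 0.
    have := cA (w *m W); rewrite wWA mulmxDl -scalemxAl wWc wWB mul0mx !scaler0.
    rewrite addr0 subr0 -mulmxA qE mul_mx_scalar => /eqP.
    by rewrite scaler_eq0 (negPf q0) => /eqP.
  have wW : w *m W = 0 by apply: obs wWB; rewrite wWA wa mul0mx add0r.
  exact: (row_free_inj Wf (etrans wW (esym (mul0mx _ W)))).
exists (block_mx 1%:M 0 0 T *m T0), (row_mx q%:M d), (row_mx l%:M z); split.
- by rewrite unitmx_mul T0u andbT unitmxE (@det_ublock _ 1 n) det1 mul1r -unitmxE.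
- rewrite adjmxM -!mulmxA.
  have -> : T0 *m (Gam *m (T0^H *m (block_mx 1%:M 0 0 T)^H)) =
      block_mx q%:M 0 0 (W *m Gam *m W^H *m T^H).
    rewrite !mulmxA adjmx_col mul_col_mx mul_col_row -[v *m _ *m _]mulmxA qE Wv vW.
    rewrite tr_block_mx map_block_mx !trmx0 !map_mx0 adjmx1 mulmx_block.
    by rewrite !mulmx0 !mul0mx !addr0 !add0r mulmx1.
  rewrite (@mulmx_block _ 1 n 1 n 1 n) !mulmx0 !mul0mx !addr0 !add0r mul1mx mulmxA Td.
  rewrite (@diag_mx_row _ n 1 q%:M d).
  by apply: (congr1 (fun X => @block_mx K 1 n 1 n X 0 0 (diag_mx d)));
    apply/matrixP => i j; rewrite !ord1 !mxE.
- move=> i; case: (@split_ordP 1 n i) => j ->.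
    by rewrite (@row_mxEl _ _ 1 n) ord1 mxE eqxx.
  by rewrite (@row_mxEr _ _ 1 n).
- move=> i; case: (@split_ordP 1 n i) => j ->.
    by rewrite !(@row_mxEl _ _ 1 n) ord1 !mxE eqxx !mulr1n.
  by rewrite !(@row_mxEr _ _ 1 n).
have -> : char_poly A = char_poly M.
  by rewrite /M char_poly_conj // mulVmx.
have -> : char_poly M = ('X - l%:P) * char_poly A'.
  rewrite ME /char_poly /char_poly_mx (@map_block_mx _ _ _ 1 n 1 n) map_mx0.
  rewrite (@scalar_mx_block _ 1 n) (@opp_block_mx _ 1 n 1 n) (@add_block_mx _ 1 n 1 n).
  rewrite oppr0 addr0 (@det_lblock _ 1 n); congr (_ * _).
  by rewrite det_mx11 !mxE eqxx !mulr1n.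
rewrite cz big_ord_recl; congr (_ * _).
  have -> : ord0 = lshift n (ord0 : 'I_1) by apply: val_inj.
  by rewrite (@row_mxEl _ _ 1 n) mxE eqxx mulr1n.
apply: eq_bigr => i _; congr ('X - _%:P).
have -> : lift ord0 i = rshift 1 i by apply: val_inj.
by rewrite (@row_mxEr _ _ 1 n).
Qed.

Lemma mulr_gt0_signE (K : numDomainType) (a b : K) : a \is Num.real -> 0 < a * b ->
  (0 < b) = (0 < a) /\ (b < 0) = (a < 0).
Proof.
move=> ar; case: (real_ltgtP ar (real0 _)) => [a0|a0|->].
- by rewrite nmulr_rgt0 // => b0; rewrite b0 lt_gtF.
- by rewrite pmulr_rgt0 // => b0; rewrite b0 lt_gtF.
by rewrite mul0r ltxx.
Qed.

Lemma lyapunov_count n r (A Gam : 'M[C]_n) (B : 'M[C]_(n, r)) :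
  hermitian_mx Gam -> A *m Gam - Gam *m A^H = (2 * 'i) *: (B *m B^H) ->
  (forall l (v : 'rV_n), v *m A = l *: v -> v *m B = 0 -> v = 0) ->
  nzeros (fun z => 0 < 'Im z) (char_poly A) = inertia_pos Gam /\
  nzeros (fun z => 'Im z < 0) (char_poly A) = inertia_neg Gam.
Proof.
move=> GH AG obs; have [T [d [z [Tu Td dr dz cz]]]] := lyapunov_inertia GH AG obs.
have [U [V [e [er [GU eV] -> -> _]]]] := inertia_diag GH.
have [<- <-] : #|[set i | (0 < d 0 i)%R]| = #|[set j | (0 < e 0 j)%R]| /\
    #|[set i | (d 0 i < 0)%R]| = #|[set j | (e 0 j < 0)%R]|.
  apply: (@diag_congr_card _ _ _ d e (T *m U) (V *m invmx T)) => //.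
    by rewrite -Td GU !adjmxM !mulmxA.
  rewrite eV -Td adjmxM -!mulmxA; congr (_ *m _).
  rewrite mulKmx //; congr (_ *m _).
  by rewrite mulmxA -adjmxM mulVmx // adjmx1 mul1mx.
have -> : char_poly A = 1 *: \prod_(w <- [seq z 0 i | i <- enum 'I_n]) ('X - w%:P).
  by rewrite scale1r cz big_map big_enum.
rewrite !nzeros_prod ?oner_neq0 // !count_map_enum.
by split; apply: eq_card => i; rewrite !inE;
  have [e1 e2] := mulr_gt0_signE (dr i) (dz i); rewrite ?e1 ?e2.
Qed.

(** * Coprime factorizations and minimal realizations *)

(** [Pi Pi'] fixes [Gam] on the left and, [Gam] being Hermitian, its adjoint fixes [Gam] on the
    right. [G1] is the form induced modulo the kernel, invertible because its size is the rank of
    [Gam]. *)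
Lemma hermitian_factor (K : numClosedFieldType) n (Gam : 'M[K]_n) : Gam^H = Gam ->
  exists r (Pi : 'M[K]_(n, r)) (Pi' : 'M[K]_(r, n)) (G1 : 'M[K]_r),
    [/\ Pi' *m Pi = 1%:M, Gam = Pi *m G1 *m Pi^H, G1 = Pi' *m Gam *m Pi'^H,
        G1^H = G1 & G1 \in unitmx].
Proof.
move=> GH; have [Pi [Pi' [PP PG]]] : exists (Pi : 'M[K]_(n, \rank Gam)) Pi',
    Pi' *m Pi = 1%:M /\ Pi *m (Pi' *m Gam) = Gam.
  exists (col_base Gam), (pinvmx (col_base Gam)).
  have PP : pinvmx (col_base Gam) *m col_base Gam = 1%:M.
    by apply: mulVpmx; apply: col_base_full.
  split=> //; rewrite -[RHS]mulmx_base; congr (_ *m _).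
  by rewrite -[X in _ *m X = _]mulmx_base mulmxA PP mul1mx.
pose G1 := Pi' *m Gam *m Pi'^H.
have GE : Gam = Pi *m G1 *m Pi^H.
  have GP : Gam *m Pi'^H *m Pi^H = Gam.
    by have := congr1 (fun X => X^H) PG; rewrite !adjmxM GH.
  by rewrite -[LHS]GP -[X in X *m _ *m _ = _]PG /G1 !mulmxA.
exists (\rank Gam), Pi, Pi', G1; split=> //; first by rewrite /G1 !adjmxM adjmxK GH mulmxA.
have : (\rank (Pi *m G1 *m Pi^H) <= \rank G1)%N.
  by rewrite -mulmxA (leq_trans (mxrankM_maxr _ _)) ?mxrankM_maxl.
by rewrite -GE -row_free_unit /row_free eqn_leq rank_leq_row.
Qed.

(** Formally, [G^-1 Z = E T^-1] are two coprime factorizations. The Bezout identities make [M]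
    unimodular, and [M] times the block matrix with rows [(T, 0)], [(E, 1)] has rows [(1, Y)],
    [(0, - G)]; compare determinants. *)
Lemma coprime_det (K : fieldType) p n (Z : 'M[{poly K}]_(p, n)) (T : 'M_n)
    (G : 'M_p) (E : 'M_(p, n)) (X : 'M_n) (Y : 'M_(n, p)) (X2 : 'M_(n, p))
    (Y2 : 'M_p) :
  Z *m T = G *m E -> X *m T + Y *m E = 1%:M -> Z *m X2 + G *m Y2 = 1%:M ->
  exists2 c, c != 0 & \det G = c *: \det T.
Proof.
move=> ZT XT ZX; pose M := block_mx X Y Z (- G).
have Mu : \det M * \det (block_mx T X2 E (- Y2)) = 1.
  rewrite -det_mulmx mulmx_block XT ZT !mulNmx !mulmxN opprK ZX subrr.
  by rewrite det_ublock !det1 mulr1.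
have MT : \det M * \det T = (-1) ^+ p * \det G.
  have := congr1 (fun X => \det X)
    (mulmx_block X Y Z (- G) T 0 E (1%:M : 'M_p)).
  rewrite /= det_mulmx det_lblock det1 mulr1 => ->.
  by rewrite XT ZT !mulmx0 !mulmx1 !add0r mulNmx subrr det_ublock det1 mul1r -detZ scaleN1r.
have : \det M \is a GRing.unit by apply/unitrPr; eexists; exact: Mu.
rewrite poly_unitE => /andP[/eqP/eq_leq/size1_polyC Mc cu].
exists ((-1) ^+ p * (\det M)`_0).
  by rewrite mulf_neq0 ?signr_eq0 // -unitfE.
rewrite -mul_polyC polyCM -Mc -mulrA MT mulrA.
by rewrite rmorphXn /= rmorphN rmorph1 -exprD addnn -mul2n exprM sqrrN !expr1n mul1r.
Qed.

Local Notation "A %:MP" := (map_mx polyC A) (at level 2, format "A %:MP").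

Lemma mulmx_regl (K : fieldType) p q (L : 'M[{poly K}]_p) (A B : 'M_(p, q)) :
  \det L != 0 -> L *m A = L *m B -> A = B.
Proof.
move=> L0 /(congr1 (mulmx (\adj L))); rewrite !mulmxA mul_adj_mx !mul_scalar_mx.
by move=> /matrixP e; apply/matrixP => i j; have := e i j; rewrite !mxE => /(mulfI L0).
Qed.

Lemma adjmx_char (K : numClosedFieldType) n (A : 'M[K]_n) :
  map_mx (map_poly Num.conj) ('X%:M - A%:MP)^T = 'X%:M - (A^H)%:MP.
Proof.
rewrite linearB /= tr_scalar_mx map_mxB map_scalar_mx /= map_polyX; congr (_ - _).
by apply/matrixP => i j; rewrite !mxE map_polyC.
Qed.

Lemma adjmx_poly (K : numClosedFieldType) m n (A : 'M[K]_(m, n)) :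
  map_mx (map_poly Num.conj) (A%:MP)^T = (A^H)%:MP.
Proof. by apply/matrixP => i j; rewrite !mxE map_polyC. Qed.

Lemma adjmx_bezout (K : numClosedFieldType) n p (A : 'M[K]_n) (E : 'M[K]_(p, n))
    X Y :
  X *m ('X%:M - A%:MP) + Y *m E%:MP = 1%:M ->
  exists X' Y', ('X%:M - (A^H)%:MP) *m X' + (E^H)%:MP *m Y' = 1%:M.
Proof.
move=> /(congr1 (fun M => map_mx (map_poly Num.conj) M^T)).
rewrite linearD /= !trmx_mul map_mxD !map_mxM adjmx_char adjmx_poly trmx1 map_mx1.
by eexists; eexists; eassumption.
Qed.

(* Passing to the quotient of the row space by ker Gam makes the realization
   D^-1 N = E (x - A)^-1 Gam E^H minimal; then D - iN = Fh (D1 - i N1), and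
   D1 - i N1 is a coprime companion of x - K1 with K1 = A1 + i G1 E1^H E1. *)
Lemma realization_zeros p n (A Gam : 'M[C]_n) (E : 'M[C]_(p, n))
    (Psi : 'M[{poly C}]_(p, n)) X Y (D N Fh D1 N1 U V : matpoly p) :
  hermitian_mx Gam -> A *m Gam = Gam *m A^H ->
  X *m ('X%:M - A%:MP) + Y *m E%:MP = 1%:M ->
  Psi *m ('X%:M - A%:MP) = D *m E%:MP -> N = Psi *m (Gam *m E^H)%:MP ->
  D = Fh *m D1 -> N = Fh *m N1 -> D1 *m U + N1 *m V = 1%:M -> \det D != 0 ->
  let G := D - 'i%:P *: N in
  [/\ \det G != 0,
    nzeros (fun z => 0 < 'Im z) (\det G) = (inertia_pos Gam + gamma_up Fh)%N
  & nzeros (fun z => 'Im z < 0) (\det G) = (inertia_neg Gam + gamma_down Fh)%N].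
Proof.
move=> GH AG XY PsiD NE DE N1E UV detD0 G.
have Fh0 : \det Fh != 0 by apply: contra_neq detD0 => e; rewrite DE det_mulmx e mul0r.
have [r [Pi [Pi' [G1 [PP GE G1E G1H G1u]]]]] := hermitian_factor GH.
have [Gp Gpd] : exists W, W = G1 *m Pi^H by eexists.
have [R Rd] : exists W, W = Pi'^H *m invmx G1 by eexists.
have PPH : Pi^H *m Pi'^H = 1%:M by rewrite -adjmxM PP adjmx1.
have GpR : Gp *m R = 1%:M.
  by rewrite Gpd Rd mulmxA -[G1 *m _ *m _]mulmxA PPH mulmx1 mulmxV.
have GamE : Gam = Pi *m Gp by rewrite Gpd mulmxA.
have [A1 A1d] : exists W, W = Pi' *m A *m Pi by eexists.
have [E1 E1d] : exists W, W = E *m Pi by eexists.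
have [B1 B1d] : exists W, W = G1 *m E1^H by eexists.
have A1Gp : A1 *m Gp = Gp *m A^H.
  have -> : A1 *m Gp = Pi' *m (A *m Gam) by rewrite GamE A1d !mulmxA.
  by rewrite AG GamE !mulmxA PP mul1mx.
(* [A Gam = Gam A^H] makes the column space of [Gam], spanned by [Pi], invariant under [A]; [A1] is
   the restriction. *)
have APi : A *m Pi = Pi *m A1.
  rewrite -[A *m Pi]mulmx1 -GpR mulmxA -[A *m Pi *m Gp]mulmxA -GamE AG GamE.
  by rewrite -[Pi *m Gp *m _]mulmxA -A1Gp -!mulmxA GpR mulmx1.
have A1G1 : A1 *m G1 = G1 *m A1^H.
  rewrite -[A1 *m G1]mulmx1 -PPH mulmxA -[A1 *m G1 *m _]mulmxA -Gpd A1Gp.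
  by rewrite Gpd -[G1 *m _ *m _]mulmxA -adjmxM APi adjmxM mulmxA -mulmxA PPH mulmx1.
have [K1 K1d] : exists W : 'M[C]_r, W = A1 + 'i *: (B1 *m E1) by eexists.
have K1G1 : K1 *m G1 - G1 *m K1^H = (2 * 'i) *: (B1 *m B1^H).
  rewrite K1d adjmxD adjmxZ mulmxDl mulmxDr A1G1 conjCi.
  rewrite opprD addrACA subrr add0r scaleNr mulmxN opprK.
  rewrite -scalemxAl -scalemxAr -scalerDr mulrC -scalerA; congr (_ *: _).
  rewrite B1d !adjmxM adjmxK G1H !mulmxA scaler_nat mulr2n; congr (_ + _).
have Pix : Pi%:MP *m ('X%:M - A1%:MP) = ('X%:M - A%:MP) *m Pi%:MP.
  by rewrite mulmxBr mulmxBl -!map_mxM APi scalar_mxC.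
have [X1 X1d] : exists W, W = Pi'%:MP *m X *m Pi%:MP by eexists.
have [Y1 Y1d] : exists W, W = Pi'%:MP *m Y by eexists.
have XY1 : X1 *m ('X%:M - A1%:MP) + Y1 *m E1%:MP = 1%:M.
  rewrite X1d Y1d E1d -[_ *m Pi%:MP *m _]mulmxA Pix map_mxM !mulmxA -mulmxDl.
  by rewrite -!mulmxA -mulmxDr XY mulmx1 -map_mxM PP map_mx1.
have [Xs [Ys XYs]] := adjmx_bezout XY.
(* The left Bezout identity splits [Psi Gam] into right multiples of [Psi Gam (x - A^H) = D E Gam]
   and of [Psi Gam E^H = N]. Both have the left factor [Fh]; [S] collects the cofactors. *)
have [S Sd] : exists W, W = D1 *m E%:MP *m Gam%:MP *m Xs + N1 *m Ys by eexists.
have PsiGam : Psi *m Gam%:MP = Fh *m S.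
  rewrite -[LHS]mulmx1 -XYs mulmxDr !mulmxA.
  have -> : Psi *m Gam%:MP *m ('X%:M - (A^H)%:MP) = D *m E%:MP *m Gam%:MP.
    rewrite -PsiD -!mulmxA; congr (_ *m _); rewrite mulmxBr mulmxBl -!map_mxM AG.
    by rewrite scalar_mxC.
  have -> : Psi *m Gam%:MP *m (E^H)%:MP = N by rewrite NE map_mxM mulmxA.
  by rewrite N1E DE Sd mulmxDr !mulmxA.
(* Since [Gam = Pi Gp] and [R] is a right inverse of [Gp], [Z] is [Psi Pi] with [Fh] cancelled on
   the left. *)
have [Z Zd] : exists W, W = S *m R%:MP by eexists.
have FhZ : Fh *m Z = Psi *m Pi%:MP.
  by rewrite Zd mulmxA -PsiGam GamE map_mxM -!mulmxA -map_mxM GpR map_mx1 mulmx1.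
have ZD : Z *m ('X%:M - A1%:MP) = D1 *m E1%:MP.
  apply: (mulmx_regl Fh0); rewrite mulmxA FhZ -mulmxA Pix mulmxA PsiD.
  by rewrite E1d map_mxM !mulmxA DE.
have N1Z : N1 = Z *m B1%:MP.
  apply: (mulmx_regl Fh0); rewrite mulmxA FhZ -N1E NE -mulmxA -map_mxM.
  by rewrite B1d E1d adjmxM GamE Gpd !mulmxA.
have [G' G'd] : exists W, W = D1 - 'i%:P *: N1 by eexists.
have xK1 : 'X%:M - K1%:MP = 'X%:M - A1%:MP - 'i%:P *: (B1%:MP *m E1%:MP).
  by rewrite K1d map_mxD opprD addrA map_mxZ map_mxM.
have [c c0 cE] : exists2 c, c != 0 & \det G' = c *: \det ('X%:M - K1%:MP).
  (* Since [x - K1 = x - A1 - i B1 E1], adding [i X1 B1] to [Y1] restores the right identity. On the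
     left, [Z B1 = N1] and [N1 (i U + V) + (D1 - i N1) U = D1 U + N1 V]. *)
  apply: (@coprime_det _ _ _ Z ('X%:M - K1%:MP) G' E1%:MP X1
     (Y1 + 'i%:P *: (X1 *m B1%:MP)) (B1%:MP *m ('i%:P *: U + V)) U).
  - by rewrite xK1 mulmxBr ZD G'd mulmxBl -scalemxAr mulmxA -N1Z -scalemxAl.
  - rewrite xK1 mulmxBr mulmxDl -scalemxAl -[X1 *m ('i%:P *: _)]scalemxAr mulmxA.
    by rewrite addrACA addNr addr0.
  rewrite mulmxA -N1Z G'd mulmxBl mulmxDr -scalemxAr -scalemxAl.
  by rewrite addrC addrA subrK.
have GE' : G = Fh *m G' by rewrite /G G'd DE N1E mulmxBr -scalemxAr.
have detG : \det G = c *: (\det Fh * char_poly K1).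
  by rewrite GE' det_mulmx cE -scalerAr.
have cK0 : char_poly K1 != 0 by exact: monic_neq0 (char_poly_monic K1).
have FK0 : \det Fh * char_poly K1 != 0 by rewrite mulf_neq0.
have [obs1 obs2] : nzeros (fun z => 0 < 'Im z) (char_poly K1) = inertia_pos G1 /\
    nzeros (fun z => 'Im z < 0) (char_poly K1) = inertia_neg G1.
  apply: (lyapunov_count G1H K1G1) => l v vK vB.
  have vA : v *m A1 = l *: v.
    by rewrite -vK K1d mulmxDr -scalemxAr mulmxA vB mul0mx scaler0 addr0.
  (* [u = v G1] is a left eigenvector of [A1^H] killed by [E1^H]; the Bezout identity makes this
     constant vector a multiple of [x - l], hence zero. *)
  have [X2 [Y2 XY2]] := adjmx_bezout XY1.
  pose u := v *m G1.
  have uA : u *m A1^H = l *: u by rewrite /u -mulmxA -A1G1 mulmxA vA -scalemxAl.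
  have uE : u *m E1^H = 0 by rewrite /u -mulmxA -B1d.
  have uX : u%:MP = ('X - l%:P) *: (u%:MP *m X2).
    rewrite -[LHS]mulmx1 -XY2 mulmxDr !mulmxA -map_mxM uE map_mx0 mul0mx addr0.
    rewrite mulmxBr -map_mxM uA mul_mx_scalar map_mxZ -scalerBl.
    by rewrite -scalemxAl.
  have u0 : u = 0.
    apply/rowP => j; have := congr1 (fun M : 'rV_r => (M 0 j).[l]) uX.
    by rewrite !mxE hornerC hornerM hornerXsubC subrr mul0r.
  by rewrite -[v]mulmx1 -(mulmxV G1u) mulmxA -/u u0 mul0mx.
have [-> ->] := inertia_congr GH G1H GE G1E.
rewrite /gamma_up /gamma_down detG scaler_eq0 negb_or c0 FK0 !nzerosZ // !nzerosM //.
by rewrite obs1 obs2 ![(nzeros _ (\det Fh) + _)%N]addnC.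
Qed.

(** * Left common divisors and the Bezout identity *)

(* Cramer: replacing column i of L by c - q L_i changes the determinant to
   (adj L c)_i - q det L; for the euclidean quotient q this is a remainder modulo det L. *)
Lemma replace_col_det (K : fieldType) p (L : 'M[{poly K}]_p) (c : 'cV_p) i q :
  \det (L + (c - (q + 1) *: col i L) *m delta_mx 0 i) =
  (\adj L *m c) i 0 - q * \det L.
Proof.
set L' := L + _.
have L'E a b : L' a b = if b == i then c a 0 - q * L a i else L a b.
  rewrite !mxE big_ord1 !mxE eqxx /=; case: eqP => [->|_]; last by rewrite mulr0 addr0.
  by rewrite mulr1 mulrDl mul1r; ring.
clearbody L'.
have cof a : cofactor L' a i = cofactor L a i.
  rewrite /cofactor; congr (_ * \det _); apply/matrixP => x y.
  by rewrite !mxE L'E eq_sym (negPf (neq_lift _ _)).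
rewrite (expand_det_col L' i).
under eq_bigr => a _ do rewrite L'E eqxx cof mulrBl -mulrA.
rewrite big_split /= sumrN -mulr_sumr -expand_det_col; congr (_ - _).
by rewrite mxE; apply: eq_bigr => a _; rewrite mxE mulrC.
Qed.

(** Euclid's algorithm measured by the degree of [\det L], where [L = W U]. If [L] does not divide
    [W] on the left, some entry of [\adj L *m W] is not a multiple of [\det L], and exchanging one
    column of [L] makes its remainder the new determinant. *)
Lemma left_gcd_exists (K : fieldType) p q (W : 'M[{poly K}]_(p, q)) U :
  \det (W *m U) != 0 ->
  exists U' Q, \det (W *m U') != 0 /\ W = W *m U' *m Q.
Proof.
have [k] := ubnP (size (\det (W *m U))); elim: k => // k IH in U *.
move=> sL L0; set L := W *m U in sL L0.
have [/forallP dvd|] := boolP [forall i, [forall j, \det L %| (\adj L *m W) i j]].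
  exists U; exists (\matrix_(i, j) ((\adj L *m W) i j %/ \det L)).
  split=> //; apply: (mulmx_regl (L := \adj L)).
    have := congr1 (fun X => \det X) (mul_adj_mx L).
    rewrite det_mulmx det_scalar => e; apply: contra_neq L0 => a0.
    by move: e; rewrite a0 mul0r => /esym/eqP; rewrite expf_eq0 => /andP[_ /eqP].
  rewrite mulmxA mul_adj_mx mul_scalar_mx; apply/matrixP => i j; rewrite [RHS]mxE.
  by rewrite [X in _ * X]mxE mulrC divpK //; have /forallP := dvd i; apply.
case/forallPn => i /forallPn [j ndvd].
pose c := col j W; pose d := (\adj L *m W) i j.
(* The added 1 in the coefficient removes the old column i of [L], leaving [c] minus the quotient
   times that column. *)
pose U' := U + (delta_mx j 0 - (d %/ \det L + 1) *: col i U) *m delta_mx 0 i.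
have L'E : W *m U' = L + (c - (d %/ \det L + 1) *: col i L) *m delta_mx 0 i.
  by rewrite /U' mulmxDr mulmxA mulmxBr -scalemxAr -colE -/c !colE -mulmxA.
have detE : \det (W *m U') = d %% \det L.
  rewrite L'E replace_col_det /c colE mulmxA -colE mxE -/d.
  by rewrite {1}(divp_eq d (\det L)) addrC addKr.
apply: (IH U'); rewrite detE; last by rewrite -/(dvdp _ _) in ndvd.
by apply: leq_trans (_ : _ < size (\det L))%N _ => //; rewrite ltn_modp.
Qed.

(** Descent from the nonsingular combination [D] yields a common left divisor that is a combination
    of [D] and [N]. By maximality [Fh] is a right multiple of it, hence also a combination, and [Fh]
    cancels. *)
Lemma gcld_bezout p (Fh D N : matpoly p) : is_gcld Fh D N -> \det D != 0 ->
  exists D1 N1 U V : matpoly p,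
    [/\ D = Fh *m D1, N = Fh *m N1 & D1 *m U + N1 *m V = 1%:M].
Proof.
move=> [[D1 DE] [N1 NE] gcd] D0.
have W0 : \det (row_mx D N *m col_mx 1%:M 0) != 0.
  by rewrite mul_row_col mulmx1 mulmx0 addr0.
have [U [Q [L0 WE]]] := left_gcd_exists W0.
set L := row_mx D N *m U in L0 WE.
have LD : ldivides L D.
  by exists (lsubmx Q); have := congr1 lsubmx WE; rewrite row_mxKl mulmx_lsub.
have LN : ldivides L N.
  by exists (rsubmx Q); have := congr1 rsubmx WE; rewrite row_mxKr mulmx_rsub.
have [M FhE] := gcd L LD LN.
exists D1, N1, (usubmx U *m M), (dsubmx U *m M); split=> //.
have Fh0 : \det Fh != 0 by apply: contra_neq D0 => e; rewrite DE det_mulmx e mul0r.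
apply: (mulmx_regl Fh0); rewrite mulmxDr !mulmxA -DE -NE -mulmxDl mulmx1.
by rewrite -mul_row_col vsubmxK -/L -FhE.
Qed.

(** * Block companion and block Hankel matrices *)

Lemma scalar_mxblock (R : pzRingType) p n (a : R) :
  a%:M = \mxblock_(i < n, j < n) (if i == j then a%:M else 0 : 'M[R]_p).
Proof.
rewrite -mxdiagZ; apply: eq_mxblock => i j.
by case: eqP => // _; rewrite conform_mx_id.
Qed.

Lemma map_mxblock (R S : Type) (f : R -> S) p q m n (B : 'I_m -> 'I_n -> 'M[R]_(p, q)) :
  map_mx f (\mxblock_(i, j) B i j) = \mxblock_(i, j) map_mx f (B i j).
Proof. by apply/matrixP => i j; rewrite !mxE. Qed.

Lemma map_mxrow (R S : Type) (f : R -> S) p q n (B : 'I_n -> 'M[R]_(p, q)) :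
  map_mx f (\mxrow_j B j) = \mxrow_j map_mx f (B j).
Proof. by apply/matrixP => i j; rewrite !mxE. Qed.

Lemma map_mxcol (R S : Type) (f : R -> S) p q n (B : 'I_n -> 'M[R]_(p, q)) :
  map_mx f (\mxcol_j B j) = \mxcol_j map_mx f (B j).
Proof. by apply/matrixP => i j; rewrite !mxE. Qed.

(* Blocks of the companion matrix of x^n + c 1 x^(n-1) + ... + c n. *)
Definition companion_block (R : pzRingType) p n (c : nat -> 'M[R]_p) (a b : nat) :
  'M[R]_p :=
  if a.+1 == n then - c (n - b)%N else (if b == a.+1 then 1%:M else 0).

Lemma mulmx_companion (R : pzRingType) p n m (c : nat -> 'M[R]_p)
    (f : nat -> 'M[R]_(m, p)) (d : nat) : (d < n)%N ->
  \sum_(j < n) f j *m companion_block n c j d =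
  (if d is d'.+1 then f d' else 0) - f n.-1 *m c (n - d)%N.
Proof.
case: n => // n dn; rewrite big_ord_recr /= /companion_block eqxx mulmxN.
congr (_ - _).
case: d dn => [|d] dn.
  apply: big1 => j _; rewrite eqSS ltn_eqF ?ltn_ord // eq_sym.
  by rewrite mulmx0.
have dn' : (d < n)%N by [].
rewrite (bigD1 (Ordinal dn')) //= big1 => [|j jd].
  by rewrite eqSS (ltn_eqF dn') eqxx mulmx1 addr0.
rewrite eqSS ltn_eqF ?ltn_ord // eqSS ifN ?mulmx0 //.
by apply: contraNN jd => /eqP e; apply/eqP/val_inj.
Qed.

Lemma companion_mulmx (R : pzRingType) p n m (c : nat -> 'M[R]_p)
    (f : nat -> 'M[R]_(p, m)) (a : nat) : (a < n)%N ->
  \sum_(j < n) companion_block n c a j *m f j =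
  if a.+1 == n then - \sum_(j < n) c (n - j)%N *m f j else f a.+1.
Proof.
move=> an; rewrite /companion_block; case: eqP => [_|/eqP ne].
  by rewrite -sumrN; apply: eq_bigr => j _; rewrite mulNmx.
have an' : (a.+1 < n)%N by rewrite ltn_neqAle ne.
rewrite (bigD1 (Ordinal an')) //= eqxx mul1mx big1 ?addr0 // => j jd.
by rewrite ifN ?mul0mx.
Qed.

Definition companion (R : pzRingType) p n (c : nat -> 'M[R]_p) :=
  \mxblock_(a < n, b < n) companion_block n c a b.

Definition block_hankel (R : Type) p n (sig : nat -> 'M[R]_p) :=
  \mxblock_(a < n, b < n) sig (a + b)%N.

Definition first_block (R : pzRingType) p n : 'M[R]_(p, \sum_(a < n) p) :=
  \mxrow_(b < n) (if b == 0%N :> nat then 1%:M else 0).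

Lemma block_hankel_adj (K : numClosedFieldType) p n (sig : nat -> 'M[K]_p) :
  (forall k, (sig k)^H = sig k) -> (block_hankel n sig)^H = block_hankel n sig.
Proof.
move=> sigH; rewrite /block_hankel tr_mxblock map_mxblock.
by apply: eq_mxblock => i j; rewrite addnC sigH.
Qed.

(** The third hypothesis says that [x^n + c 1 x^(n-1) + ...] times the series [sum_l sig_l x^-(l+1)]
    has no negative powers. The companion matrix shifts the block rows, and this recurrence supplies
    the last one. *)
Lemma companion_hankel (R : pzRingType) p n (c sig : nat -> 'M[R]_p) :
  c 0%N = 1%:M -> (forall k, (n < k)%N -> c k = 0) ->
  (forall t, (n <= t)%N -> \sum_(l < t.+1) c (t - l)%N *m sig l = 0) ->
  companion n c *m block_hankel n sig = block_hankel n (fun k => sig k.+1).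
Proof.
move=> c0 cn sigR; rewrite mul_mxblock; apply: eq_mxblock => a b.
rewrite (companion_mulmx _ (fun j => sig (j + b)%N)) //.
case: eqP => [an|//]; have := sigR _ (leq_addr b n).
rewrite -(big_mkord xpredT (fun l => c (n + b - l)%N *m sig l)).
rewrite (big_cat_nat (n := b)) //=; last by rewrite leqW ?leq_addl.
rewrite big_nat_cond big1 ?add0r => [|l /andP[/andP[_ lb] _]]; last first.
  by rewrite cn ?mul0mx // -addnBA ?(ltnW lb) // -[X in (X < _)%N]addn0 ltn_add2l subn_gt0.
rewrite -{1}[b : nat]add0n big_addn -addSn addnK big_nat_recr //= big_mkord.
rewrite subnn c0 mul1mx => /eqP; rewrite addr_eq0 => /eqP e.
rewrite -addSn an -[RHS]opprK -e; congr (- _).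
by apply: eq_bigr => j _; rewrite subnDr.
Qed.

(** The product is the shifted Hankel matrix, again Hermitian, hence its own adjoint. *)
Lemma companion_hankel_adj (K : numClosedFieldType) p n (c sig : nat -> 'M[K]_p) :
  c 0%N = 1%:M -> (forall k, (n < k)%N -> c k = 0) ->
  (forall t, (n <= t)%N -> \sum_(l < t.+1) c (t - l)%N *m sig l = 0) ->
  (forall k, (sig k)^H = sig k) ->
  companion n c *m block_hankel n sig = block_hankel n sig *m (companion n c)^H.
Proof.
move=> c0 cn sigR sigH; rewrite -[in RHS](block_hankel_adj n sigH) -adjmxM.
by rewrite companion_hankel // block_hankel_adj.
Qed.

Lemma char_companion (K : fieldType) p n (c : nat -> 'M[K]_p) :
  'X%:M - (companion n c)%:MP = \mxblock_(i < n, j < n)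
    ((if i == j then 'X%:M else 0) - companion_block n (fun k => (c k)%:MP) i j).
Proof.
rewrite mxblockB -scalar_mxblock map_mxblock; congr (_ - _).
apply: eq_mxblock => i j; rewrite /companion_block; case: eqP => _.
  by rewrite map_mxN.
by case: eqP; rewrite ?map_mx1 ?map_mx0.
Qed.

Lemma mul_char_companion (K : fieldType) p n m (c : nat -> 'M[K]_p)
    (f : nat -> 'M[{poly K}]_(m, p)) (d : 'I_n) :
  \sum_(j < n) f j *m ((if j == d then 'X%:M else 0)
      - companion_block n (fun k => (c k)%:MP) j d) =
  'X *: f d - (if nat_of_ord d is d'.+1 then f d' else 0)
    + f n.-1 *m (c (n - d)%N)%:MP.
Proof.
under eq_bigr => j _ do rewrite mulmxBr.
rewrite sumrB mulmx_companion // opprD opprK addrA; congr (_ - _ + _).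
rewrite (bigD1 d) //= eqxx mul_mx_scalar big1 ?addr0 // => j jd.
by rewrite (negPf jd) mulmx0.
Qed.

(** Block rows of [x - A] above the last read [x e_j - e_(j+1)]; weighted by [x^(b-j-1)] for [j < b]
    they telescope to [x^b e_0 - e_b], and [E = e_0]. *)
Lemma companion_observable (K : fieldType) p n (c : nat -> 'M[K]_p) :
  exists X Y, X *m ('X%:M - (companion n c)%:MP) + Y *m (first_block K p n)%:MP = 1%:M.
Proof.
pose x b j : 'M[{poly K}]_p := if (j < b)%N then - ('X^(b - j.+1))%:M else 0.
exists (\mxblock_(b < n, j < n) x b j), (\mxcol_(b < n) ('X^b)%:M).
rewrite char_companion mul_mxblock /first_block map_mxrow mul_mxcol_mxrow -mxblockD.
rewrite scalar_mxblock; apply: eq_mxblock => b d.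
rewrite (mul_char_companion c (x b)).
have -> : x b n.-1 = 0.
  by rewrite /x ifN // -leqNgt -ltnS prednK ?(leq_ltn_trans _ (ltn_ord b)).
rewrite mul0mx addr0 /x; have [/val_inj<-|bd] := eqVneq (b : nat) d.
  rewrite ltnn scaler0 sub0r; case: (b : nat) => [|b'] /=.
    by rewrite map_mx1 mulmx1 oppr0 add0r expr0 eqxx.
  by rewrite ltnSn subnn map_mx0 mulmx0 addr0 opprK expr0 eqxx.
rewrite [RHS]ifN; last by apply: contraNN bd => /eqP->.
case: (d : nat) bd => [|d'] bd /=.
  by rewrite subr0 lt0n bd map_mx1 mulmx1 scalerN scale_scalar_mx -exprS subn1
    prednK ?lt0n // addNr.
rewrite map_mx0 mulmx0 addr0; have [db|db] := ltnP d'.+1 b.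
  by rewrite (ltnW db) scalerN scale_scalar_mx -exprS opprK -subSn // addNr.
by rewrite ltnNge -ltnS ltn_neqAle bd db /= scaler0 subr0.
Qed.

(* Coefficients of the quotient of (x^n + c 1 x^(n-1) + ...) by x^(j+1). *)
Definition horner_quotient (K : fieldType) p n (c : nat -> 'M[K]_p) (j : nat) :
  'M[{poly K}]_p := \sum_(j <= t < n) 'X^(n - t.+1) *: (c (t - j)%N)%:MP.

(** Horner's scheme [q_(d-1) = x q_d + c_(n-d)], with [q_(n-1) = 1], cancels every block column but
    column 0, where the full polynomial remains. *)
Lemma horner_quotient_companion (K : fieldType) p n (c : nat -> 'M[K]_p) :
  c 0%N = 1%:M ->
  \mxrow_(j < n) horner_quotient n c j *m ('X%:M - (companion n c)%:MP) =
  (\sum_(t < n.+1) 'X^(n - t) *: (c t)%:MP) *m (first_block K p n)%:MP.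
Proof.
move=> c0; rewrite char_companion mul_mxrow_mxblock /first_block map_mxrow mul_mxrow.
apply: eq_mxrow => d; rewrite (mul_char_companion c (horner_quotient n c)).
have n0 : (0 < n)%N by apply: leq_ltn_trans (ltn_ord d).
have -> : horner_quotient n c n.-1 = 1%:M.
  rewrite /horner_quotient; case: (n) n0 => // n' _.
  by rewrite big_nat1 !subnn expr0 scale1r c0 map_mx1.
have E : 'X *: horner_quotient n c d + (c (n - d)%N)%:MP =
    \sum_(d <= t < n.+1) 'X^(n - t) *: (c (t - d)%N)%:MP.
  rewrite big_nat_recr ?(ltnW (ltn_ord d)) //= subnn expr0 scale1r; congr (_ + _).
  rewrite scaler_sumr; apply: eq_big_nat => t /andP[_ tn].
  by rewrite scalerA -exprS -subSn.
rewrite mul1mx addrAC {}E; case: (d : nat) (ltn_ord d) => [|d'] dn /=.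
  rewrite subr0 map_mx1 mulmx1 big_mkord; apply: eq_bigr => t _.
  by rewrite subn0.
rewrite map_mx0 mulmx0 big_add1 /= subrr //.
Qed.

(** [Gam E^H] has blocks [sig j], and the sum of the [q_j sig_j] is the polynomial part of
    [x^n + c 1 x^(n-1) + ...] times [sum_l sig_l x^-(l+1)]. *)
Lemma horner_quotient_hankel (K : numClosedFieldType) p n (c sig : nat -> 'M[K]_p) :
  \mxrow_(j < n) horner_quotient n c j *m
    (block_hankel n sig *m (first_block K p n)^H)%:MP =
  \sum_(t < n) 'X^(n - t.+1) *: (\sum_(l < t.+1) c (t - l)%N *m sig l)%:MP.
Proof.
rewrite /first_block tr_mxrow map_mxcol mul_mxblock_mxrow map_mxcol mul_mxrow_mxcol.
have S (j : 'I_n) : \sum_(b < n) sig (j + b)%N *m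
    ((if b == 0%N :> nat then 1%:M else 0 : 'M[K]_p)^H) = sig j.
  have n0 : (0 < n)%N by apply: leq_ltn_trans (ltn_ord j).
  rewrite (bigD1 (Ordinal n0)) //= big1 => [|b b0].
    by rewrite addr0 trmx1 map_mx1 mulmx1 addn0.
  by rewrite ifN ?trmx0 ?map_mx0 ?mulmx0.
under eq_bigr => j _ do rewrite S /horner_quotient big_geq_mkord /= mulmx_suml.
rewrite (exchange_big_dep xpredT) //=; apply: eq_bigr => t _.
rewrite (big_ord_widen n (fun l => c (t - l)%N *m sig l)) // map_mx_sum scaler_sumr.
by apply: eq_bigr => l _; rewrite -scalemxAl map_mxM.
Qed.

(** * Splitting a Hankel matrix by the parity of block indices *)

Definition block_select (K : pzRingType) p n k (f : nat -> nat) :=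
  \mxblock_(a < n, b < k) (if a == f b :> nat then 1%:M else 0 : 'M[K]_p).

Lemma block_select_adj (K : numClosedFieldType) p n k f :
  (block_select K p n k f)^H =
  \mxblock_(b < k, a < n) (if a == f b :> nat then 1%:M else 0 : 'M[K]_p).
Proof.
rewrite /block_select tr_mxblock map_mxblock; apply: eq_mxblock => b a.
by case: eqP; rewrite ?trmx1 ?map_mx1 ?trmx0 ?map_mx0.
Qed.

Lemma block_select_hankel (K : numClosedFieldType) p n k l f g (sig : nat -> 'M[K]_p) :
  (forall b, (b < k)%N -> (f b < n)%N) -> (forall b, (b < l)%N -> (g b < n)%N) ->
  (block_select K p n k f)^H *m block_hankel n sig *m block_select K p n l g =
  \mxblock_(b < k, b' < l) sig (f b + g b')%N.
Proof.
move=> fn gn; rewrite block_select_adj !mul_mxblock; apply: eq_mxblock => b b'.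
rewrite (bigD1 (Ordinal (gn _ (ltn_ord b')))) //= eqxx mulmx1.
rewrite [X in _ + X]big1 ?addr0 => [|a ag].
  rewrite (bigD1 (Ordinal (fn _ (ltn_ord b)))) //= eqxx mul1mx.
  by rewrite big1 ?addr0 // => a af; rewrite ifN ?mul0mx.
by rewrite ifN ?mulmx0.
Qed.

Lemma block_select_mul_adj (K : numClosedFieldType) p k (f : nat -> nat) a a' :
  injective f -> \sum_(b < k) (if a == f b then 1%:M else 0 : 'M[K]_p) *m
    (if a' == f b then 1%:M else 0 : 'M[K]_p) =
  if (a == a') && [exists b : 'I_k, a == f b] then 1%:M else 0.
Proof.
move=> fi; case: existsP => [[b /eqP->]|nb]; last first.
  rewrite andbF big1 // => b _; rewrite ifN ?mul0mx //.
  by apply/negP => ab; apply: nb; exists b.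
rewrite andbT (bigD1 b) //= eqxx mul1mx big1 ?addr0 => [|i ib].
  by rewrite eq_sym.
by rewrite ifN ?mul0mx // (inj_eq fi) eq_sym.
Qed.

Lemma block_select_full (K : numClosedFieldType) p n k l (f g : nat -> nat) :
  (forall a, (a < n)%N ->
     [exists b : 'I_k, a == f b] (+) [exists b : 'I_l, a == g b]) ->
  injective f -> injective g ->
  block_select K p n k f *m (block_select K p n k f)^H +
  block_select K p n l g *m (block_select K p n l g)^H = 1%:M.
Proof.
move=> fg fi gi; rewrite !block_select_adj !mul_mxblock -mxblockD scalar_mxblock.
apply: eq_mxblock => a a'; rewrite !block_select_mul_adj //.
have -> : (a == a') = (a == a' :> nat) by [].
move: (fg a (ltn_ord a)); case: (a == a' :> nat) => /=; last by rewrite addr0.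
by case: [exists b : 'I_k, _]; case: [exists b : 'I_l, _] => //= _; rewrite ?addr0 ?add0r.
Qed.

Lemma inertia_block_diag n1 n2 (A : 'M[C]_n1) (B : 'M[C]_n2) :
  inertia_pos (block_mx A 0 0 B) = (inertia_pos A + inertia_pos B)%N /\
  inertia_neg (block_mx A 0 0 B) = (inertia_neg A + inertia_neg B)%N.
Proof.
have E : char_poly (block_mx A 0 0 B) = char_poly A * char_poly B.
  rewrite /char_poly /char_poly_mx map_block_mx !map_mx0 scalar_mx_block.
  by rewrite opp_block_mx add_block_mx oppr0 !addr0 det_lblock.
have c0 n (M : 'M[C]_n) : char_poly M != 0 by exact: monic_neq0 (char_poly_monic M).
by rewrite /inertia_pos /inertia_neg E !nzerosM.
Qed.

Definition interleave p (s : nat -> 'M[C]_p) k := if odd k then 0 else s k./2.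

(* The even and odd block indices decouple: s_(a+b) vanishes for a, b of opposite
   parities. *)
Lemma inertia_interleave p n (s : nat -> 'M[C]_p) : (forall i, hermitian_mx (s i)) ->
  inertia_pos (block_hankel n (interleave s)) =
    (inertia_pos (hankel s 0 (uphalf n)) + inertia_pos (hankel s 1 n./2))%N /\
  inertia_neg (block_hankel n (interleave s)) =
    (inertia_neg (hankel s 0 (uphalf n)) + inertia_neg (hankel s 1 n./2))%N.
Proof.
move=> sH; set H := block_hankel _ _; set H0 := hankel s 0 _; set H1 := hankel s 1 _.
have HH : hermitian_mx H.
  apply: block_hankel_adj => k; rewrite /interleave; case: odd; last exact: sH.
  by rewrite trmx0 map_mx0.
(* Below n there are [uphalf n] even and [n./2] odd indices. Two odd ones add up to
   [2 (b + b' + 1)], whence the shift by 1 in [H1]. *)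
pose f b := b.*2; pose g b := b.*2.+1.
pose W0 := block_select C p n (uphalf n) f; pose W1 := block_select C p n n./2 g.
have fn b : (b < uphalf n)%N -> (f b < n)%N by rewrite /f; lia.
have gn b : (b < n./2)%N -> (g b < n)%N by rewrite /g; lia.
have W00 : W0^H *m H *m W0 = H0.
  rewrite block_select_hankel //; apply: eq_mxblock => b b'.
  by rewrite /interleave /f -doubleD odd_double doubleK.
have W11 : W1^H *m H *m W1 = H1.
  rewrite block_select_hankel //; apply: eq_mxblock => b b'.
  by rewrite /interleave /g addSn addnS -doubleD -doubleS odd_double doubleK.
have W01 : W0^H *m H *m W1 = 0.
  rewrite block_select_hankel // -[RHS]mxblock0; apply: eq_mxblock => b b'.
  by rewrite /interleave /f /g addnS -doubleD /= odd_double.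
have W10 : W1^H *m H *m W0 = 0.
  rewrite block_select_hankel // -[RHS]mxblock0; apply: eq_mxblock => b b'.
  by rewrite /interleave /f /g addSn -doubleD /= odd_double.
have WW : W0 *m W0^H + W1 *m W1^H = 1%:M.
  apply: block_select_full => [a an||]; last 2 first.
  - exact: double_inj.
  - by move=> x y [/double_inj].
  have -> : [exists b : 'I_(uphalf n), a == f b] = ~~ odd a.
    apply/existsP/idP => [[b /eqP->]|na]; first by rewrite odd_double.
    have lt : (a./2 < uphalf n)%N by lia.
    by exists (Ordinal lt); rewrite /f /=; apply/eqP; lia.
  have -> : [exists b : 'I_n./2, a == g b] = odd a.
    apply/existsP/idP => [[b /eqP->]|na]; first by rewrite /= odd_double.
    have lt : (a./2 < n./2)%N by lia.
    by exists (Ordinal lt); rewrite /g /=; apply/eqP; lia.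
  by rewrite addNb addbb.
have [<- <-] := inertia_block_diag H0 H1; set B := block_mx H0 0 0 H1.
have BE : B = (row_mx W0 W1)^H *m H *m row_mx W0 W1.
  by rewrite adjmx_row mul_col_mx mul_col_row W00 W01 W10 W11.
have BH : hermitian_mx B by rewrite /hermitian_mx BE !adjmxM adjmxK HH mulmxA.
have TT : row_mx W0 W1 *m (row_mx W0 W1)^H = 1%:M.
  by rewrite adjmx_row mul_row_col WW.
apply: (@inertia_congr _ _ _ _ (row_mx W0 W1) (row_mx W0 W1)^H) => //.
  by rewrite BE !mulmxA TT mul1mx -mulmxA TT mulmx1.
by rewrite adjmxK.
Qed.

(** * The pair D, N attached to [F(ix)] *)

Definition mpoly_sum (K : fieldType) p n (c : nat -> 'M[K]_p) : 'M[{poly K}]_p :=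
  \sum_(t < n.+1) 'X^(n - t) *: (c t)%:MP.

(** Up to a nonzero constant this is the characteristic polynomial of the companion matrix. [X2]
    picks the last Horner quotient, which is 1, so the left Bezout identity is immediate. *)
Lemma det_monic_mpoly (K : numClosedFieldType) p n (c : nat -> 'M[K]_p) : (0 < n)%N ->
  c 0%N = 1%:M -> size (\det (mpoly_sum n c)) = (n * p).+1.
Proof.
move=> n0 c0; have [X [Y XY]] := companion_observable n c.
pose X2 : 'M[{poly K}]_(\sum_(j < n) p, p) :=
  \mxcol_(j < n) (if j == n.-1 :> nat then 1%:M else 0 : 'M_p).
have ZX : \mxrow_(j < n) horner_quotient n c j *m X2 + mpoly_sum n c *m 0 = 1%:M.
  rewrite mulmx0 addr0 mul_mxrow_mxcol.
  have ln : (n.-1 < n)%N by rewrite prednK.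
  rewrite (bigD1 (Ordinal ln)) //= eqxx mulmx1 big1 ?addr0 => [|j jn].
    rewrite /horner_quotient; case: (n) n0 => // n' _.
    by rewrite big_nat1 !subnn expr0 scale1r c0 map_mx1.
  by rewrite ifN ?mulmx0.
have [a a0 ->] := coprime_det (horner_quotient_companion n c0) XY ZX.
rewrite -/(char_poly_mx _) -/(char_poly _).
by rewrite size_scale // size_char_poly sum_nat_const card_ord.
Qed.

Lemma gcld_sym p (L A B : matpoly p) : is_gcld L A B -> is_gcld L B A.
Proof. by move=> [h1 h2 h3]; split=> // M hA hB; apply: h3. Qed.

Lemma ldivides_scale p (L A : matpoly p) (a : {poly C}) :
  ldivides L A -> ldivides L (a *: A).
Proof. by move=> [M ->]; exists (a *: M); rewrite scalemxAr. Qed.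

Lemma gcld_scale p (L A B : matpoly p) (a b a' b' : {poly C}) :
  a' * a = 1 -> b' * b = 1 -> is_gcld L A B -> is_gcld L (a *: A) (b *: B).
Proof.
move=> aa bb [h1 h2 h3]; split; try exact: ldivides_scale.
move=> M /(ldivides_scale a') + /(ldivides_scale b').
by rewrite !scalerA aa bb !scale1r; apply: h3.
Qed.

Lemma sum_even_terms (V : nmodType) u (G : nat -> V) :
  (forall l, odd l -> G l = 0) ->
  \sum_(l < u.*2) G l = \sum_(v < u) G v.*2 /\
  \sum_(l < u.*2.+1) G l = \sum_(v < u.+1) G v.*2.
Proof.
move=> G0; have E : \sum_(l < u.*2) G l = \sum_(v < u) G v.*2.
  elim: u => [|u IH]; first by rewrite !big_ord0.
  by rewrite doubleS !big_ord_recr /= IH [G u.*2.+1]G0 ?addr0 //= odd_double.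
by split=> //; rewrite !big_ord_recr /= E.
Qed.

Lemma signrB (R : pzRingType) a b : (b <= a)%N ->
  (-1) ^+ (a - b) = (-1) ^+ a * (-1) ^+ b :> R.
Proof. by move=> ba; rewrite -{2}(subnK ba) exprD -mulrA -expr2 sqrr_sign mulr1. Qed.

Lemma signmx_poly (K : fieldType) m n k (A : 'M[K]_(m, n)) :
  ((-1) ^+ k *: A)%:MP = (-1) ^+ k *: A%:MP.
Proof. by rewrite map_mxZ rmorphXn /= rmorphN rmorph1. Qed.

Lemma sign_scale (R : comPzRingType) (V : lmodType R) m v x y (A : V) : (v <= m)%N ->
  (x * y) *: ((-1) ^+ v *: A) =
  (-1) ^+ m *: (x *: (y *: ((-1) ^+ (m - v) *: A))).
Proof.
move=> vm; rewrite signrB // !scalerA; congr (_ *: _); rewrite -[LHS](signrMK m).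
by rewrite -!mulrA; congr (_ * _); rewrite !mulrA [_ * x]mulrC -!mulrA [(-1) ^+ m * (y * _)]mulrCA.
Qed.

(* D and N with F(ix) = i^n (D(x) - i N(x)). *)
Definition dcoef p (F : matpoly p) n k :=
  if odd k then 0 else (-1) ^+ k./2 *: coefA F n k.
Definition ncoef p (F : matpoly p) n k :=
  if odd k then (-1) ^+ k./2 *: coefA F n k else 0.

(** Coefficient form of [N = D (sum_l sig_l x^-(l+1))]. The sign [(-1)^u] of N times [(-1)^v] of the
    expansion is the sign [(-1)^(u-v)] of D; for odd t every term has a zero factor. *)
Lemma dcoef_interleave p (F : matpoly p) n (s : nat -> 'M[C]_p) t :
  (forall u, coefA F n u.*2.+1 =
     \sum_(v < u.+1) coefA F n (u - v).*2 *m ((-1) ^+ v *: s v)) ->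
  \sum_(l < t.+1) dcoef F n (t - l) *m interleave s l = ncoef F n t.+1.
Proof.
move=> rec; rewrite /ncoef /=; case: (boolP (odd t)) => ot /=.
  apply: big1 => l _; rewrite /interleave /dcoef oddB -1?ltnS // ot.
  by case: odd; rewrite ?mulmx0 ?mul0mx.
have [u ->] : exists u, t = u.*2 by exists t./2; rewrite -[LHS]odd_double_half (negPf ot).
have [l ol|_ ->] := @sum_even_terms _ u (fun l => dcoef F n (u.*2 - l) *m interleave s l).
  by rewrite /interleave ol mulmx0.
rewrite uphalf_double rec scaler_sumr; apply: eq_bigr => v _.
rewrite /dcoef /interleave -doubleB !odd_double !doubleK -scalemxAl -scalemxAr scalerA.
congr (_ *: _); have vu : (v <= u)%N by rewrite -ltnS.
by rewrite signrB // -mulrA -expr2 sqrr_sign mulr1.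
Qed.

Lemma mcoef_mpoly_of p (c : nat -> 'M[C]_p) d k :
  mcoef (mpoly_of c d) d k = if (k <= d)%N then c k else 0.
Proof.
rewrite /mcoef; case: leqP => // kd; apply/matrixP => i j; rewrite !mxE coef_sum.
rewrite (bigD1 (Ordinal (kd : k < d.+1)%N)) //= coefCM coefXn eqxx mulr1.
rewrite big1 ?addr0 // => l lk; rewrite coefCM coefXn.
suff /negPf-> : (d - k)%N != (d - l)%N by rewrite mulr0.
by apply: contraNneq lk => e; apply/eqP/val_inj => /=; have := ltn_ord l; lia.
Qed.

Lemma coefA_gt p (F : matpoly p) n k : (n < k)%N -> coefA F n k = 0.
Proof. by rewrite /coefA ltnNge => /negPf->. Qed.

(** For even n the expansion starts at [z^-1], and entry [u.+1] of the odd part is coefficient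
    [2 u + 1] of F. For odd n it starts at [z^0] with the parts exchanged, and entry [u] of the even
    part is that same coefficient. *)
Lemma markov_left_rec p (F : matpoly p) n (s : nat -> 'M[C]_p) u :
  markov_params false F n s ->
  coefA F n u.*2.+1 = \sum_(v < u.+1) coefA F n (u - v).*2 *m ((-1) ^+ v *: s v).
Proof.
rewrite /markov_params /laurent1_left /laurent2_left /even_part /odd_part.
case: (boolP (odd n)) => on /= [_ /(_ u)] E.
  transitivity (mcoef (mpoly_of (even_coef F n) n./2) n./2 u).
    rewrite mcoef_mpoly_of /even_coef on /=; case: leqP => h.
      by congr coefA; lia.
    by rewrite coefA_gt //; lia.
  rewrite E; apply: eq_bigr => v _; congr (_ *m _).
  rewrite mcoef_mpoly_of /odd_coef on /= mul2n; case: leqP => h //.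
  by rewrite coefA_gt //; lia.
transitivity (mcoef (mpoly_of (odd_coef F n) n./2) n./2 u.+1).
  rewrite mcoef_mpoly_of /odd_coef on /=; case: ltnP => h.
    by congr coefA; lia.
  by rewrite coefA_gt //; lia.
rewrite E; apply: eq_bigr => v _; congr (_ *m _).
rewrite mcoef_mpoly_of /even_coef on /= mul2n; case: leqP => h //.
by rewrite coefA_gt //; lia.
Qed.

Lemma mpoly_of_negsq p (c : nat -> 'M[C]_p) d :
  subst_negsq (mpoly_of c d) =
  \sum_(k < d.+1) 'X^((d - k).*2) *: ((-1) ^+ (d - k) *: c k)%:MP.
Proof.
apply/matrixP => i j; rewrite mxE mxE summxE rmorph_sum /=.
apply: eq_bigr => k _; rewrite !mxE rmorphM /= comp_polyC rmorphXn /= comp_polyX.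
have -> : (- 'X^2) ^+ (d - k) = (-1) ^+ (d - k) * 'X^((d - k).*2) :> {poly C}.
  by rewrite [LHS]exprNn -exprM mul2n.
by rewrite polyCM rmorphXn /= rmorphN rmorph1 mulrC mulrAC mulrC.
Qed.

Definition dpoly p (F : matpoly p) n := mpoly_sum n (dcoef F n).
Definition npoly p (F : matpoly p) n := mpoly_sum n (ncoef F n).

(** The signs here and below come from dividing [F_e(-x^2) + i x F_o(-x^2)] by [i^n]. For [n = 2m]
    the factor [-i] of N causes an extra minus sign; for [n = 2m + 1] the parts exchange roles. *)
Lemma dpoly_even p (F : matpoly p) m :
  dpoly F m.*2 = ((-1) ^+ m) *: subst_negsq (even_part F m.*2).
Proof.
rewrite /even_part doubleK !mpoly_of_negsq.
have [l ol|_ E] := @sum_even_terms _ m (fun t => 'X^(m.*2 - t) *: (dcoef F m.*2 t)%:MP).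
  by rewrite /dcoef ol map_mx0 scaler0.
rewrite /dpoly /mpoly_sum E scaler_sumr; apply: eq_bigr => v _.
rewrite /dcoef /even_coef !odd_double /= doubleK mul2n -doubleB !signmx_poly.
have vm : (v <= m)%N by rewrite -ltnS.
by rewrite -[X in X *: _ = _]mul1r (sign_scale _ _ _ vm) scale1r.
Qed.

Lemma npoly_even p (F : matpoly p) m :
  npoly F m.*2 = (- (-1) ^+ m) *: ('X *: subst_negsq (odd_part F m.*2)).
Proof.
rewrite /odd_part doubleK !mpoly_of_negsq.
rewrite /npoly /mpoly_sum big_ord_recl /= {1}/ncoef /= map_mx0 scaler0 add0r.
have [l ol|E _] := @sum_even_terms _ m (fun t => 'X^(m.*2 - t.+1) *: (ncoef F m.*2 t.+1)%:MP).
  by rewrite /ncoef /= ol map_mx0 scaler0.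
rewrite E big_ord_recl /odd_coef odd_double /= scaler0 map_mx0 scaler0 add0r !scaler_sumr.
apply: eq_bigr => v _; rewrite /bump /= add1n mul2n doubleS subn1 /=.
rewrite /ncoef /= odd_double /= uphalf_double !signmx_poly.
have vm : (v < m)%N by [].
have -> : (m.*2 - v.*2.+1 = (m - v.+1).*2.+1)%N by lia.
rewrite exprS scaleNr -(sign_scale _ _ _ vm).
by rewrite [(-1) ^+ v.+1]exprS mulN1r [in RHS]scaleNr scalerN opprK.
Qed.

Lemma dpoly_odd p (F : matpoly p) m :
  dpoly F m.*2.+1 = ((-1) ^+ m) *: ('X *: subst_negsq (odd_part F m.*2.+1)).
Proof.
rewrite /odd_part /= uphalf_double !mpoly_of_negsq.
have [l ol|E _] := @sum_even_terms _ m.+1 (fun t => 'X^(m.*2.+1 - t) *: (dcoef F m.*2.+1 t)%:MP).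
  by rewrite /dcoef ol map_mx0 scaler0.
rewrite /dpoly /mpoly_sum -doubleS E !scaler_sumr; apply: eq_bigr => v _.
rewrite /dcoef /odd_coef /= !odd_double /= doubleK mul2n !signmx_poly.
have vm : (v <= m)%N by rewrite -ltnS.
have -> : (m.*2.+1 - v.*2 = (m - v).*2.+1)%N by lia.
by rewrite exprS (sign_scale _ _ _ vm).
Qed.

Lemma npoly_odd p (F : matpoly p) m :
  npoly F m.*2.+1 = ((-1) ^+ m) *: subst_negsq (even_part F m.*2.+1).
Proof.
rewrite /even_part /= uphalf_double !mpoly_of_negsq.
rewrite /npoly /mpoly_sum big_ord_recl /= {1}/ncoef /= map_mx0 scaler0 add0r.
have [l ol|_ E] := @sum_even_terms _ m (fun t => 'X^(m.*2.+1 - t.+1) *: (ncoef F m.*2.+1 t.+1)%:MP).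
  by rewrite /ncoef /= ol map_mx0 scaler0.
rewrite E !scaler_sumr; apply: eq_bigr => v _.
rewrite /ncoef /even_coef /= !odd_double /= uphalf_double mul2n addn1 !signmx_poly.
have vm : (v <= m)%N by rewrite -ltnS.
by rewrite subSS -doubleB -[X in X *: _ = _]mul1r (sign_scale _ _ _ vm) scale1r.
Qed.

Lemma imag_coef p (F : matpoly p) n t : (t <= n)%N ->
  'i ^+ (n - t) *: coefA F n t = 'i ^+ n *: (dcoef F n t - 'i *: ncoef F n t).
Proof.
move=> tn; have -> : ('i : C) ^+ n = 'i ^+ (n - t) * 'i ^+ t by rewrite -exprD subnK.
have -> : ('i : C) ^+ t = 'i ^+ odd t * (-1) ^+ t./2.
  by rewrite -{1}[t]odd_double_half exprD -mul2n exprM sqrCi.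
rewrite -!scalerA; congr (_ *: _); rewrite /dcoef /ncoef; case: odd.
  rewrite sub0r expr1 !scalerN !scalerA -[_ * 'i * _]mulrA mulrACA -!expr2 sqrCi.
  by rewrite sqrr_sign mulr1 scaleN1r opprK.
by rewrite scaler0 subr0 scale1r scalerA -expr2 sqrr_sign scale1r.
Qed.

Lemma mpoly_sum_coefA p n (F : matpoly p) : (forall i j, size (F i j) <= n.+1)%N ->
  F = mpoly_sum n (coefA F n).
Proof.
move=> sF; apply/matrixP => i j; rewrite summxE.
have -> : F i j = \poly_(k < n.+1) (F i j)`_k.
  apply/polyP => k; rewrite coef_poly; case: ltnP => // h.
  by rewrite nth_default // (leq_trans (sF i j)).
rewrite poly_def (reindex_inj rev_ord_inj) /=; apply: eq_bigr => t _.
by rewrite !mxE /coefA -ltnS ltn_ord mxE subSS -mul_polyC mulrC.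
Qed.

Lemma horner_imag p n (F : matpoly p) :
  (forall i j, size (F i j) <= n.+1)%N ->
  map_mx (fun q : {poly C} => q \Po ('i *: 'X)) F =
  ('i ^+ n)%:P *: (dpoly F n - 'i%:P *: npoly F n).
Proof.
move=> sF; rewrite {1}(mpoly_sum_coefA sF) /dpoly /npoly /mpoly_sum scaler_sumr -sumrB scaler_sumr.
apply/matrixP => i j; rewrite mxE !summxE rmorph_sum; apply: eq_bigr => t _.
rewrite !mxE rmorphM /= comp_polyC rmorphXn /= comp_polyX exprZn.
have tn : (t <= n)%N by rewrite -ltnS.
have := congr1 (fun M : 'M_p => M i j) (imag_coef F tn); rewrite !mxE => E.
rewrite -mul_polyC mulrAC -polyCM E mulrC ['i%:P * _]mulrCA -mulrBr mulrCA.
by rewrite -polyCM -polyCB -polyCM.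
Qed.

Lemma nzeros_horner_imag p n (F : matpoly p) (P : pred C) :
  (forall i j, size (F i j) <= n.+1)%N ->
  \det (dpoly F n - 'i%:P *: npoly F n) != 0 ->
  \det F != 0 /\
  nzeros P (\det (dpoly F n - 'i%:P *: npoly F n)) =
  nzeros (fun z => P (z / 'i)) (\det F).
Proof.
move=> sF; set G := dpoly F n - _ => G0.
have E : \det F \Po ('i *: 'X) = ('i ^+ n) ^+ p *: \det G.
  have := congr1 (fun M => \det M) (horner_imag sF); rewrite detZ -rmorphXn mul_polyC => <-.
  by rewrite (det_map_mx (comp_poly ('i *: 'X))).
have i0 : ('i ^+ n) ^+ p != 0 :> C by rewrite !expf_neq0 // neq0Ci.
have F0 : \det F != 0.
  apply: contra_neq G0 => e; move: E; rewrite e comp_poly0 => /esym/eqP.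
  by rewrite scaler_eq0 (negPf i0) => /eqP.
by split=> //; rewrite -nzeros_comp_linear ?neq0Ci // E nzerosZ.
Qed.

(** * Zero counts from the recurrence *)

Lemma inertia_hankel_total p (s : nat -> 'M[C]_p) j k :
  (inertia_pos (hankel s j k) + inertia_neg (hankel s j k)
   + inertia_zero (hankel s j k))%N = (k * p)%N.
Proof. by rewrite inertia_total sum_nat_const card_ord. Qed.

Lemma nzeros_eq (P Q : pred C) q : P =1 Q -> nzeros P q = nzeros Q q.
Proof. by move=> PQ; apply: eq_count. Qed.

Lemma zeros_left_half p n (F : matpoly p) (s : nat -> 'M[C]_p) (Fh : matpoly p) :
  (0 < n)%N -> monic_mpoly_deg F n ->
  (forall u, coefA F n u.*2.+1 =
     \sum_(v < u.+1) coefA F n (u - v).*2 *m ((-1) ^+ v *: s v)) ->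
  (forall k, hermitian_mx (s k)) -> is_gcld Fh (dpoly F n) (npoly F n) ->
  let H0 := hankel s 0 (uphalf n) in let H1 := hankel s 1 n./2 in
  [/\ gamma_left F = (inertia_pos H0 + inertia_pos H1 + gamma_up Fh)%N,
      gamma_right F = (inertia_neg H0 + inertia_neg H1 + gamma_down Fh)%N &
      Posz (gamma_imag F) = Posz (inertia_zero H0 + inertia_zero H1)%N
        - Posz (gamma_up Fh) - Posz (gamma_down Fh)].
Proof.
move=> n0 [sF F0] rec sH gcd H0 H1.
have d0 : dcoef F n 0 = 1%:M by rewrite /dcoef /= expr0 scale1r.
have dn k : (n < k)%N -> dcoef F n k = 0.
  by move=> nk; rewrite /dcoef coefA_gt // scaler0; case: odd.
have sigH k : (interleave s k)^H = interleave s k.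
  by rewrite /interleave; case: odd; [rewrite trmx0 map_mx0|apply: sH].
have sigR t : \sum_(l < t.+1) dcoef F n (t - l) *m interleave s l = ncoef F n t.+1.
  exact: dcoef_interleave.
have AG : companion n (dcoef F n) *m block_hankel n (interleave s) =
    block_hankel n (interleave s) *m (companion n (dcoef F n))^H.
  (* N has no coefficient of index above n: this is the recurrence required of [sig]. *)
  apply: companion_hankel_adj => // t nt; rewrite sigR /ncoef.
  by rewrite coefA_gt // scaler0; case: odd.
have sD := det_monic_mpoly n0 d0.
have D0 : \det (dpoly F n) != 0 by rewrite -size_poly_eq0 sD.
have [D1 [N1 [U [V [DE NE UV]]]]] := gcld_bezout gcd D0.
have [X [Y XY]] := companion_observable n (dcoef F n).
have NQ : npoly F n = \mxrow_(j < n) horner_quotient n (dcoef F n) j *m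
    (block_hankel n (interleave s) *m (first_block C p n)^H)%:MP.
  rewrite horner_quotient_hankel /npoly /mpoly_sum big_ord_recl /ncoef /= map_mx0.
  rewrite scaler0 add0r; apply: eq_bigr => t _.
  by rewrite sigR.
have [G0 up down] := realization_zeros (block_hankel_adj n sigH) AG XY
  (horner_quotient_companion n d0) NQ DE NE UV D0.
have [<- <-] := inertia_interleave n sH.
have ReIm (z : C) : 'Im (z / 'i) = - 'Re z.
  by rewrite invCi mulrN raddfN /= mulrC ImMil.
have L : gamma_left F = (inertia_pos (block_hankel n (interleave s)) + gamma_up Fh)%N.
  rewrite -up (nzeros_horner_imag _ sF G0).2.
  by apply: nzeros_eq => z; rewrite ReIm oppr_gt0.
have R : gamma_right F = (inertia_neg (block_hankel n (interleave s)) + gamma_down Fh)%N.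
  rewrite -down (nzeros_horner_imag _ sF G0).2.
  by apply: nzeros_eq => z; rewrite ReIm oppr_lt0.
split=> //; have [Fn0 _] := nzeros_horner_imag predT sF G0.
have := size_poly_zeros Fn0.
rewrite {2}(mpoly_sum_coefA sF) (det_monic_mpoly n0 F0) => -[tot].
have := count_sign_partition (poly_zeros (\det F)) (fun z => Creal_Re z).
rewrite -!/(nzeros _ _) -/(gamma_right F) -/(gamma_left F) -/(gamma_imag F) tot.
have := inertia_hankel_total s 0 (uphalf n); rewrite -/H0.
have := inertia_hankel_total s 1 n./2; rewrite -/H1.
have : (uphalf n * p + n./2 * p = n * p)%N by rewrite -mulnDl; congr (_ * _)%N; lia.
have [] := inertia_interleave n sH; rewrite -/H0 -/H1 => e1 e2.
rewrite L R e1 e2; lia.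
Qed.

(** * Transposition, and both kinds of Markov parameters *)

Lemma coefA_tr p (F : matpoly p) n k : coefA F^T n k = (coefA F n k)^T.
Proof.
by rewrite /coefA; case: leqP => _; rewrite ?trmx0 //; apply/matrixP => i j; rewrite !mxE.
Qed.

Lemma mcoef_tr p (P : matpoly p) d k : mcoef P^T d k = (mcoef P d k)^T.
Proof.
by rewrite /mcoef; case: leqP => _; rewrite ?trmx0 //; apply/matrixP => i j; rewrite !mxE.
Qed.

Lemma even_part_tr p (F : matpoly p) n : even_part F^T n = (even_part F n)^T.
Proof.
apply/matrixP => i j; rewrite !mxE; apply: eq_bigr => k _.
by rewrite /even_coef !coefA_tr; case: ifP; rewrite mxE.
Qed.

Lemma odd_part_tr p (F : matpoly p) n : odd_part F^T n = (odd_part F n)^T.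
Proof.
apply/matrixP => i j; rewrite !mxE; apply: eq_bigr => k _.
by rewrite /odd_coef !coefA_tr; case: ifP; [case: ifP|]; rewrite !mxE.
Qed.

Lemma markov_tr p (F : matpoly p) n (s : nat -> 'M[C]_p) :
  markov_params true F n s -> markov_params false F^T n (fun k => (s k)^T).
Proof.
have tr_sum (a b : nat -> 'M[C]_p) t :
    (\sum_(k < t.+1) a k *m b (t - k)%N)^T = \sum_(k < t.+1) (b (t - k)%N)^T *m (a k)^T.
  by rewrite raddf_sum; apply: eq_bigr => k _; rewrite /= trmx_mul.
have sz_tr (P : matpoly p) i j : P^T i j = P j i by rewrite mxE.
rewrite /markov_params even_part_tr odd_part_tr.
case: ifP => _ /= [sz E].
all: split=> [i j|t]; [by rewrite sz_tr; apply: sz|rewrite mcoef_tr E].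
all: rewrite (tr_sum (fun k => (-1) ^+ k *: s k)); apply: eq_bigr => k _.
all: by rewrite mcoef_tr linearZ.
Qed.

Lemma ldivides_tr p (L F : matpoly p) : ldivides L^T F^T <-> rdivides L F.
Proof.
split=> -[M FE]; exists M^T; last by rewrite FE trmx_mul.
by rewrite -[F]trmxK FE trmx_mul trmxK.
Qed.

Lemma gcld_tr p (L A B : matpoly p) : is_gcrd L A B -> is_gcld L^T A^T B^T.
Proof.
move=> [hA hB h]; split; try exact/ldivides_tr.
by move=> M; rewrite -[M]trmxK !ldivides_tr; apply: h.
Qed.

Lemma char_poly_tr (K : fieldType) n (A : 'M[K]_n) : char_poly A^T = char_poly A.
Proof.
rewrite /char_poly -[RHS]det_tr; congr (\det _).
by rewrite /char_poly_mx linearB /= tr_scalar_mx map_trmx.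
Qed.

Lemma hankel_tr p (s : nat -> 'M[C]_p) j k :
  hankel (fun i => (s i)^T) j k = (hankel s j k)^T.
Proof. by rewrite /hankel tr_mxblock; apply: eq_mxblock => a b; rewrite addnAC. Qed.

Lemma zeros_left_markov p n (F : matpoly p) (s : nat -> 'M[C]_p) (Fh : matpoly p) :
  (0 < n)%N -> monic_mpoly_deg F n -> markov_params false F n s ->
  (forall k, hermitian_mx (s k)) ->
  is_gcld Fh (subst_negsq (even_part F n)) ('X *: subst_negsq (odd_part F n)) ->
  let H0 := hankel s 0 (uphalf n) in let H1 := hankel s 1 n./2 in
  [/\ gamma_left F = (inertia_pos H0 + inertia_pos H1 + gamma_up Fh)%N,
      gamma_right F = (inertia_neg H0 + inertia_neg H1 + gamma_down Fh)%N &
      Posz (gamma_imag F) = Posz (inertia_zero H0 + inertia_zero H1)%N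
        - Posz (gamma_up Fh) - Posz (gamma_down Fh)].
Proof.
move=> n0 mF mk sH gcd; apply: zeros_left_half => // [u|]; first exact: markov_left_rec.
have sq m : (-1) ^+ m * (-1) ^+ m = 1 :> {poly C} by rewrite -expr2 sqrr_sign.
have sqN m : (- (-1) ^+ m) * (- (-1) ^+ m) = 1 :> {poly C} by rewrite mulrNN.
(* D and N are the given polynomials up to sign, in exchanged order when n is odd. *)
move: gcd; rewrite -[n]odd_double_half; case: odd => /= gcd.
  by rewrite add1n in gcd *; rewrite dpoly_odd npoly_odd; apply/gcld_scale/gcld_sym/gcd.
by rewrite add0n in gcd *; rewrite dpoly_even npoly_even; apply: gcld_scale gcd.
Qed.

(* right = true : right Markov parameters and a greatest right common divisor;
   right = false: left Markov parameters and a greatest left common divisor. *)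
Theorem theorem3p5 (right : bool) (p n : nat) (F : matpoly p)
    (s : nat -> 'M[C]_p) (Fh : matpoly p) :
  (0 < n)%N ->
  monic_mpoly_deg F n ->
  markov_params right F n s ->
  (forall k, hermitian_mx (s k)) ->
  (let P := subst_negsq (even_part F n) in
   let Q := 'X *: subst_negsq (odd_part F n) in
   if right then is_gcrd Fh P Q else is_gcld Fh P Q) ->
  let m := n./2 in
  (* paper: H_{m-1} (n = 2m), resp. H_m (n = 2m+1), and H_{1,m-1} *)
  let H0 := hankel s 0 (if ~~ odd n then m else m.+1) in
  let H1 := hankel s 1 m in
  [/\ gamma_left F = (inertia_pos H0 + inertia_pos H1 + gamma_up Fh)%N,
      gamma_right F = (inertia_neg H0 + inertia_neg H1 + gamma_down Fh)%N &
      Posz (gamma_imag F) =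
        Posz (inertia_zero H0 + inertia_zero H1)%N
        - Posz (gamma_up Fh) - Posz (gamma_down Fh)].
Proof.
move=> n0 mF mk sH gcd m H0 H1.
have mE : (if ~~ odd n then m else m.+1) = uphalf n.
  by rewrite uphalf_half -/m; case: odd.
rewrite /H0 mE {H0 mE} /H1 {H1}.
case: right mk gcd => mk gcd; last exact: zeros_left_markov.
(* Transposing every [s k] transposes the whole Hankel matrix, whose block pattern is symmetric;
   determinants and characteristic polynomials do not change. *)
have := @zeros_left_markov p n F^T (fun k => (s k)^T) Fh^T n0.
rewrite /gamma_left /gamma_right /gamma_imag /gamma_up /gamma_down !det_tr !hankel_tr.
rewrite /inertia_pos /inertia_neg /inertia_zero !char_poly_tr; apply.
- have [sF F0] := mF; split=> [i j|]; first by rewrite mxE.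
  by rewrite coefA_tr F0 trmx1.
- exact: markov_tr.
- by move=> k; rewrite /hermitian_mx -{2}(sH k) trmxK map_trmx trmxK.
- have := gcld_tr gcd; rewrite even_part_tr odd_part_tr linearZ /=.
  by rewrite /subst_negsq !map_trmx.
Qed.
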